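(* Let $\mathcal{X}$ be a radial tree with the measure $\mu$ and let $\mathcal{P}$ be the Bergman projector on $\mathcal{X}$, all as described in the context. There is a constant $C>0$, depending only on $(\mathcal{X},\mu)$, such that for all $f_1,f_2\in L^1(\mathcal{X})$ there exists a sparse collection $\mathcal{S}\subseteq\mathscr{D}$ with $$ |\langle \mathcal{P} f_1,f_2\rangle|\le C\Big(\langle \mathcal{A}_{\mathcal{S}}|f_1|,|f_2|\rangle+\mathcal{E}_{\mathcal{S}}(|f_1|,|f_2|)\Big). $$
   Context: **Tree and measure.** $\mathcal{X}$ is an infinite tree (connected graph without cycles) with a distinguished vertex $0$ (origin), $d$ is the graph distance and $|x|=d(x,0)$. The number of children of $x$ (neighbours $y$ of $x$ with $|y|=|x|+1$) is denoted $q(x)$. $\mathcal{X}$ is radial: there is $\tilde q:\{0,1,2,\dots\}\to\{2,3,4,\dots\}$ with $q(x)=\tilde q(|x|)$ for all $x$ ($\tilde q$ may be unbounded). For $x\ne 0$, $x^{(1)}$ is the neighbour of $x$ with $|x^{(1)}|=|x|-1$, and $x^{(k)}$ is the $k$-th iterate. Fix $\alpha>1$ and let $\mu(\{x\})=c\prod_{\ell=0}^{|x|-1}\tilde q(\ell)^{-\alpha}$, with $c>0$ chosen so that $\mu(\mathcal{X})=1$. $L^p(\mathcal{X})=L^p(\mathcal{X},\mu)$ (real-valued functions), and $\langle f,g\rangle=\sum_{x\in\mathcal{X}}f(x)g(x)\mu(\{x\})$. For $Q\subseteq\mathcal{X}$, $\langle f\rangle_Q=\mu(Q)^{-1}\sum_{x\in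 Q}f(x)\mu(\{x\})$. **Dyadic sets.** The sector with vertex $x$ is $S_x=\{x\}\cup\{y: y^{(k)}=x\text{ for some }k\ge1\}$. $\mathscr{D}$ is the family of all sectors $S_x$ and all singletons $\{x\}$, $x\in\mathcal{X}$. The parent $Q^{(1)}$ of $Q\in\mathscr{D}$, $Q\neq\mathcal{X}=S_0$, is: $\{x\}^{(1)}=S_x$, and $S_x^{(1)}=S_{x^{(1)}}$ for $x\neq0$. For a sector $Q=S_x$, write $x_Q=x$, so $x_Q^{(1)}$ is the vertex of $Q^{(1)}$. **Bergman projector.** The combinatorial Laplacian is $\Delta f(x)=f(x)-\frac{1}{\#\{y:d(x,y)=1\}}\sum_{y:d(x,y)=1}f(y)$; $f$ is harmonic if $\Delta f=0$ on $\mathcal{X}$. The Bergman space $\mathcal{A}^2(\mathcal{X})$ is the closed subspace of harmonic functions in $L^2(\mathcal{X})$. $\mathcal{P}$ is the orthogonal projection of $L^2(\mathcal{X})$ onto $\mathcal{A}^2(\mathcal{X})$. It is given by $\mathcal{P}f(x)=\sum_y K(x,y)f(y)\mu(\{y\})$, where $K$ is the reproducing kernel of $\mathcal{A}^2(\mathcal{X})$; for each fixed $x$, $K(x,\cdot)$ is bounded, and $\mathcal{P}f$ is defined by this formula for $f\in L^1(\mathcal{X})$. **Sparse objects.** A collection $\mathcal{S}\subseteq\mathscr{D}$ is sparse if for each $Q\in\mathcal{S}$ there is $E_Q\subseteq Q$ with $\mu(E_Q)\ge\frac12\mu(Q)$ and the sets $\{E_Q\}_{Q\in\mathcal{S}}$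 are pairwise disjoint. The sparse operator is $\mathcal{A}_{\mathcal{S}}f(x)=\sum_{Q\in\mathcal{S}}\langle f\rangle_Q 1_Q(x)$. For nonnegative $g_1,g_2$, $$ \mathcal{E}_{\mathcal{S}}(g_1,g_2)=\sum_{Q}\langle g_1\rangle_Q\Big(\frac{1}{q(x_Q^{(1)})}\sum_{R}\langle g_2\rangle_R\Big)\mu(Q), $$ where $Q$ runs over the sectors (non-singletons) in $\mathcal{S}$ with $Q\ne\mathcal{X}$, and, for each $Q$, $R$ runs over the sectors in $\mathcal{S}$ with $R^{(1)}=Q^{(1)}$ (including $R=Q$ itself). The right-hand side of the inequality takes values in $[0,\infty]$. *)

(* Defs.v *)
From HB Require Import structures.
From mathcomp Require Import all_boot all_order all_algebra finmap.
From mathcomp Require Import all_classical all_reals all_analysis.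

Set Implicit Arguments.
Unset Strict Implicit.
Unset Printing Implicit Defensive.
Import Order.TTheory GRing.Theory Num.Theory.
Local Open Scope classical_set_scope.
Local Open Scope ring_scope.

(* Sum of an absolutely summable real family; a non-summable family, whose sum
   is undefined, gets a junk value. *)
Definition rsum (R : realType) (T : choiceType) (A : set T) (f : T -> R) : R :=
  fine (esum A (EFin \o f)^\+ - esum A (EFin \o f)^\-)%E.

Section Tree.
Variables (V : choiceType) (adj : rel V).

Definition is_tree : Prop :=
  [/\ symmetric adj, irreflexive adj,
      forall x y, exists p, path adj x p /\ last x p = y
    & forall p : seq V, uniq p -> cycle adj p -> (size p < 3)%N].

Definition walk_lengths (x y : V) : set nat :=
  [set n | exists p, [/\ path adj x p, last x p = y & size p = n]].

Definition dist (x y : V) : nat :=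
  xget 0%N [set n | walk_lengths x y n /\
                    forall m, walk_lengths x y m -> (n <= m)%N].

Definition neighbours (x : V) : set V := [set y | dist x y = 1%N].

Variable o : V.

Definition height (x : V) : nat := dist x o.

Definition children (x : V) : set V :=
  [set y | neighbours x y /\ height y = (height x).+1].

Definition nchildren (x : V) : nat := #|` fset_set (children x)|.

(* The cardinal of an infinite set under [fset_set] is 0, hence the explicit
   finiteness. *)
Definition radial (q : nat -> nat) : Prop :=
  forall x, finite_set (children x) /\ nchildren x = q (height x).

(* The origin has no parent; here [parent o = o]. *)
Definition parent (x : V) : V :=
  xget x [set y | neighbours x y /\ height x = (height y).+1].

(* The convention [parent o = o] is harmless: the iterates that reach a vertex
   other than [o] do not pass through [o], and [k = 0] is the case [y = x]. *)
Definition sector (x : V) : set V :=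
  [set y | exists k, iter k parent y = x].

Definition is_sector (Q : set V) : Prop := exists x, Q = sector x.

Definition dyadic : set (set V) :=
  [set Q | is_sector Q \/ exists x, Q = [set x]].

Definition sector_vertex (Q : set V) : V := xget o [set x | Q = sector x].

(* Only meaningful on sectors other than the whole tree. *)
Definition sector_parent (Q : set V) : set V :=
  sector (parent (sector_vertex Q)).

Definition proper_sectors (S : set (set V)) : set (set V) :=
  [set Q | [/\ S Q, is_sector Q & Q <> [set: V]]].

(* The whole tree has no parent, so it is nobody's sibling. *)
Definition siblings (S : set (set V)) (Q : set V) : set (set V) :=
  [set P | proper_sectors S P /\ sector_parent P = sector_parent Q].

Variable R : realType.
Implicit Types f g : V -> R.

Definition laplacian f (x : V) : R :=
  f x - (#|` fset_set (neighbours x)|)%:R^-1 * \sum_(y \in neighbours x) f y.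

Definition harmonic f : Prop := forall x, laplacian f x = 0.

Definition weight (q : nat -> nat) (alpha c : R) (x : V) : R :=
  c * \prod_(l < height x) (q l)%:R `^ (- alpha).

(* [w x] is the mass of the point [x]. *)
Variable w : V -> R.

Definition mass (Q : set V) : \bar R := \esum_(x in Q) (w x)%:E.

Definition inL1 f : Prop :=
  (\esum_(x in [set: V]) (`|f x| * w x)%:E < +oo)%E.

Definition inL2 f : Prop :=
  (\esum_(x in [set: V]) (f x ^+ 2 * w x)%:E < +oo)%E.

Definition inner f g : R := rsum [set: V] (fun x => f x * g x * w x).

Definition inner_converges f g : Prop :=
  summable [set: V] (fun x => (f x * g x * w x)%:E).

Definition average f (Q : set V) : R :=
  (fine (mass Q))^-1 * rsum Q (fun x => f x * w x).

Definition bergman f : Prop := inL2 f /\ harmonic f.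

(* [bergman_kernel x y] is K(x, y): its section at x is the element of the
   Bergman space representing the evaluation at x. *)
Definition bergman_kernel (x : V) : V -> R :=
  xget (fun=> 0)
    [set k | bergman k /\ forall f, bergman f -> f x = inner f k].

(* On L^2 this is the orthogonal projection onto the Bergman space. *)
Definition bergman_projector f (x : V) : R :=
  rsum [set: V] (fun y => bergman_kernel x y * f y * w y).

Definition sparse (S : set (set V)) : Prop :=
  S `<=` dyadic /\
  exists2 E : set V -> set V,
    forall Q, S Q -> E Q `<=` Q /\ ((2^-1)%:E * mass Q <= mass (E Q))%E
    & trivIset S E.

(* For S included in [dyadic], only finitely many terms are nonzero: a vertex
   lies in finitely many sectors. *)
Definition sparse_operator (S : set (set V)) f (x : V) : R :=
  \sum_(Q \in S) average f Q * \1_Q x.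

(* The two forms below are meant for nonnegative functions. *)
Definition sparse_form (S : set (set V)) f g : \bar R :=
  \esum_(x in [set: V]) (sparse_operator S f x * g x * w x)%:E.

Definition sibling_form (S : set (set V)) f g : \bar R :=
  \esum_(Q in proper_sectors S)
    (average f Q *
     ((nchildren (parent (sector_vertex Q)))%:R^-1 *
      \sum_(P \in siblings S Q) average g P) * fine (mass Q))%:E.

End Tree.

(* Main.v *)
Require Import Defs.
From mathcomp Require Import all_boot all_order all_algebra finmap.
From mathcomp Require Import all_classical all_reals all_analysis.
From mathcomp Require Import ring lra zify.
Import Order.TTheory GRing.Theory Num.Theory.
Local Open Scope classical_set_scope.
Local Open Scope ring_scope.

(** The Bergman space of a radial tree splits orthogonally into the constants
    and, for each vertex [z], the harmonic functions that live strictly below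
    [z], are radial on the sector of each child of [z], and have values on the
    children of [z] adding up to zero.  If [z] has height [k], such a function
    is [a v * phi k (height y)] on the sector of the child [v], where [phi k]
    solves the radial harmonic recurrence with [phi k k = 0] and
    [phi k k.+1 = 1].  Since a vertex has at least two children, the increments
    of [phi k] decay geometrically, so [1 <= phi k n <= 2] for [k < n].

    Summing the projections onto these pieces gives an explicit kernel:
    [kernel x y] is 1 plus, for every common strict ancestor [z] of [x] and [y],
      [phi k |x| * phi k |y| / N_k * (1 - 1/q)] or [- phi k |x| * phi k |y| / N_k / q],
    according to whether [x] and [y] descend from the same child of [z]; here
    [N_k] is the squared norm of [phi k] on the sector of a child of [z].
    Instead of proving that the orthogonal sum is the whole Bergman space,
    [kernel_reproducing] checks the reproducing formula directly: level sums of a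
    harmonic function below a vertex are explicit
    ([iter_child_sum_harmonic]), so each term of the kernel returns a combination
    of two consecutive increments of the function along the branch from the origin
    to [x], and these combinations telescope ([sum_phi_telescope]).

    As [N_k] is at least the mass of the sector of a child, the projector is
    dominated pointwise ([projector_le]): |P f (x)| is at most 4 times the sum,
    over the sectors containing [x], of the average of |f| on the sector and of
    the averages of |f| on its siblings, the sector included, the latter divided by
    their number.
    Integrating against |f2| gives the two forms of the theorem, but for the
    family of all sectors.  That family need not be sparse.  However the mass of
    the successive levels of a sector decays by the factor [2 `^ (1 - alpha)] at
    least, so if [m] is so large that the [m]-th power of this factor is at most
    1/2, the first [m] levels of any sector carry at least half of its mass.  Hence the
    sectors whose vertex has height congruent to [i] modulo [m] form a sparse
    family ([sparse_level_sectors]), and siblings belong to the same family.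
    The full forms are the sums over [i < m] of the forms of these families; the
    family for which the sum of both forms is largest therefore works, with
    [C = 4 * m]. *)

Set Implicit Arguments.
Unset Strict Implicit.
Unset Printing Implicit Defensive.

(** * Sums of absolutely summable real families *)

Section RealSums.
Variable R : realType.

Definition abs_summable (T : choiceType) (A : set T) (h : T -> R) : Prop :=
  summable A (EFin \o h).

Lemma esumZl (T : choiceType) (A : set T) (h : T -> \bar R) (k : R) :
  0 <= k -> (forall x, A x -> 0 <= h x)%E ->
  (\esum_(x in A) (k%:E * h x) = k%:E * \esum_(x in A) h x)%E.
Proof.
move=> k0 h0; rewrite /esum -ereal_supZl //; last first.
  by apply/set0P; exists (\sum_(x \in set0) h x)%E, set0 => //; split.
congr ereal_sup; rewrite image_comp; apply: eq_imagel => X [finX XA] /=.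
rewrite !fsbig_finite// big_seq [in RHS]big_seq ge0_sume_distrr// => x.
by rewrite in_fset_set// inE => /XA/h0.
Qed.

Section OneSet.
Variables (T : choiceType) (A : set T).
Implicit Types h g : T -> R.

Lemma abs_summableE h :
  abs_summable A h = (\esum_(x in A) `|h x|%:E < +oo)%E.
Proof. by []. Qed.

Lemma abs_summable_ge0E h : (forall x, A x -> 0 <= h x) ->
  abs_summable A h = (\esum_(x in A) (h x)%:E < +oo)%E.
Proof.
move=> h0; rewrite abs_summableE; congr (_ < _)%E.
by apply: eq_esum => x Ax; rewrite ger0_norm// h0.
Qed.

Lemma abs_summable_le h g :
  (forall x, A x -> `|h x| <= g x) -> abs_summable A g -> abs_summable A h.
Proof.
move=> hg; apply: le_lt_trans; apply: le_esum => x Ax /=.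
by rewrite lee_fin (le_trans (hg _ Ax))// ler_norm.
Qed.

Lemma abs_summable_eq h g :
  (forall x, A x -> h x = g x) -> abs_summable A g -> abs_summable A h.
Proof. by move=> hg; apply: le_lt_trans; apply: le_esum => x Ax /=; rewrite hg. Qed.

Lemma abs_summable_abs h : abs_summable A h -> abs_summable A (fun x => `|h x|).
Proof. by apply: le_lt_trans; apply: le_esum => x Ax /=; rewrite normr_id. Qed.

Lemma abs_summableD h g :
  abs_summable A h -> abs_summable A g -> abs_summable A (fun x => h x + g x).
Proof. exact: summableD. Qed.

Lemma abs_summableZ k h : abs_summable A h -> abs_summable A (fun x => k * h x).
Proof.
rewrite !abs_summableE => Ah.
under eq_esum do rewrite normrM EFinM.
rewrite esumZl// lte_mul_pinfty//.
Qed.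

Lemma abs_summable0 : abs_summable A (fun=> 0).
Proof. by rewrite abs_summableE esum1// => x _; rewrite normr0. Qed.

Lemma abs_summable_sum (I : Type) (r : seq I) (P : pred I) (F : I -> T -> R) :
  (forall i, P i -> abs_summable A (F i)) ->
  abs_summable A (fun x => \sum_(i <- r | P i) F i x).
Proof.
move=> FP; elim: r => [|i r IH].
  by apply: abs_summable_eq abs_summable0 => x _; rewrite big_nil.
case: (boolP (P i)) => Pi.
  apply: abs_summable_eq (abs_summableD (FP _ Pi) IH) => x _.
  by rewrite big_cons Pi.
by apply: abs_summable_eq IH => x _; rewrite big_cons (negPf Pi).
Qed.

Lemma fine_esumK h : (forall x, A x -> 0 <= h x) -> abs_summable A h ->
  ((fine (\esum_(x in A) (h x)%:E))%:E = \esum_(x in A) (h x)%:E)%E.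
Proof.
move=> h0 Ah; rewrite fineK// ge0_fin_numE; last first.
  by apply: esum_ge0 => x Ax; rewrite lee_fin h0.
by move: Ah; apply: le_lt_trans; apply: le_esum => x Ax /=; rewrite lee_fin ler_norm.
Qed.

(** A signed sum may be computed from any decomposition into a difference of
    nonnegative summable families; linearity and summation by blocks below are
    reduced to nonnegative families this way. *)
Lemma rsumB_ge0 h g : (forall x, A x -> 0 <= h x) -> (forall x, A x -> 0 <= g x) ->
  abs_summable A h -> abs_summable A g ->
  rsum A (fun x => h x - g x) =
  fine (\esum_(x in A) (h x)%:E) - fine (\esum_(x in A) (g x)%:E).
Proof.
move=> h0 g0 Ah Ag; rewrite /rsum.
have -> : (EFin \o (fun x => (h x - g x)%R) = (EFin \o h) \- (EFin \o g))%E by [].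
rewrite esumB//; do ?by move=> x Ax; rewrite /= lee_fin ?h0 ?g0.
by rewrite fineB// -fine_esumK.
Qed.

Lemma rsum_ge0E h : (forall x, A x -> 0 <= h x) -> abs_summable A h ->
  rsum A h = fine (\esum_(x in A) (h x)%:E).
Proof.
move=> h0 Ah.
have -> : rsum A h = rsum A (fun x => h x - (fun=> 0) x).
  by congr rsum; apply/funext => x; rewrite subr0.
rewrite rsumB_ge0//; last exact: abs_summable0.
by rewrite (@esum1 _ _ _ (fun=> 0%E))// subr0.
Qed.

Lemma rsum_ge0 h : (forall x, A x -> 0 <= h x) -> abs_summable A h -> 0 <= rsum A h.
Proof.
move=> h0 Ah; rewrite rsum_ge0E//; apply: fine_ge0.
by apply: esum_ge0 => x Ax; rewrite lee_fin h0.
Qed.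

Lemma EFin_rsum h : (forall x, A x -> 0 <= h x) -> abs_summable A h ->
  (rsum A h)%:E = \esum_(x in A) (h x)%:E.
Proof. by move=> h0 Ah; rewrite rsum_ge0E// fine_esumK. Qed.

Lemma eq_rsum h g : (forall x, A x -> h x = g x) -> rsum A h = rsum A g.
Proof.
move=> hg; rewrite /rsum; congr (fine (_ - _)%E); apply: eq_esum => x Ax.
  by rewrite !funeposE /= hg.
by rewrite !funenegE /= hg.
Qed.

Definition pos_part h x := Num.max (h x) 0.
Definition neg_part h x := Num.max (- h x) 0.

Lemma pos_partB h x : h x = pos_part h x - neg_part h x.
Proof.
rewrite /pos_part /neg_part.
by case: (leP (h x) 0) => H; case: (leP (- h x) 0) => H'; lra.
Qed.

Lemma pos_part_ge0 h x : 0 <= pos_part h x.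
Proof. by rewrite /pos_part le_max lexx orbT. Qed.

Lemma neg_part_ge0 h x : 0 <= neg_part h x.
Proof. by rewrite /neg_part le_max lexx orbT. Qed.

Lemma abs_summable_pos h : abs_summable A h -> abs_summable A (pos_part h).
Proof.
move=> Ah; apply: abs_summable_le (abs_summable_abs Ah) => x _.
by rewrite /pos_part; case: (leP (h x) 0) => H; rewrite ?normr0.
Qed.

Lemma abs_summable_neg h : abs_summable A h -> abs_summable A (neg_part h).
Proof.
move=> Ah; apply: abs_summable_le (abs_summable_abs Ah) => x _.
by rewrite /neg_part; case: (leP (- h x) 0) => H; rewrite ?normr0 ?normrN.
Qed.

Lemma rsum_pos_neg h : abs_summable A h ->
  rsum A h = fine (\esum_(x in A) (pos_part h x)%:E)
           - fine (\esum_(x in A) (neg_part h x)%:E).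
Proof.
move=> Ah; rewrite -rsumB_ge0.
- by apply: eq_rsum => x _; exact: pos_partB.
- by move=> x _; exact: pos_part_ge0.
- by move=> x _; exact: neg_part_ge0.
- exact: abs_summable_pos.
- exact: abs_summable_neg.
Qed.

Lemma fine_esumD h g : (forall x, A x -> 0 <= h x) -> (forall x, A x -> 0 <= g x) ->
  abs_summable A h -> abs_summable A g ->
  fine (\esum_(x in A) (h x + g x)%:E) =
  fine (\esum_(x in A) (h x)%:E) + fine (\esum_(x in A) (g x)%:E).
Proof.
move=> h0 g0 Ah Ag; under eq_esum do rewrite EFinD.
rewrite esumD//; last first.
by rewrite -(fine_esumK h0)// -(fine_esumK g0)// fineD.
Qed.

Lemma rsumD h g : abs_summable A h -> abs_summable A g ->
  rsum A (fun x => h x + g x) = rsum A h + rsum A g.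
Proof.
move=> Ah Ag.
transitivity (rsum A (fun x => (pos_part h x + pos_part g x)
                             - (neg_part h x + neg_part g x))).
  by apply: eq_rsum => x _; rewrite (pos_partB h) (pos_partB g); ring.
rewrite (rsum_pos_neg Ah) (rsum_pos_neg Ag).
have hp x := pos_part_ge0 h x; have hn x := neg_part_ge0 h x.
have gp x := pos_part_ge0 g x; have gn x := neg_part_ge0 g x.
have [Ahp Ahn] := (abs_summable_pos Ah, abs_summable_neg Ah).
have [Agp Agn] := (abs_summable_pos Ag, abs_summable_neg Ag).
rewrite rsumB_ge0; do ?by [move=> x _; exact: addr_ge0|exact: abs_summableD].
by rewrite (fine_esumD (h := pos_part h))// (fine_esumD (h := neg_part h))// opprD addrACA.
Qed.

Lemma rsumZ_ge0 k h : 0 <= k -> (forall x, A x -> 0 <= h x) -> abs_summable A h ->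
  rsum A (fun x => k * h x) = k * rsum A h.
Proof.
move=> k0 h0 Ah; rewrite rsum_ge0E; last exact: abs_summableZ.
  under eq_esum do rewrite EFinM.
  by rewrite esumZl// -fine_esumK// -?rsum_ge0E//=.
by move=> x Ax; rewrite mulr_ge0// h0.
Qed.

Lemma rsumN h : abs_summable A h -> rsum A (fun x => - h x) = - rsum A h.
Proof.
move=> Ah; apply/eqP; rewrite -addr_eq0 -rsumD//; last first.
  by apply: abs_summable_le (abs_summable_abs Ah) => x _; rewrite normrN.
rewrite (_ : rsum _ _ = rsum A (fun=> 0)); last by apply: eq_rsum => x _; rewrite addNr.
by rewrite rsum_ge0E//; [rewrite esum1|exact: abs_summable0].
Qed.

Lemma rsumZ k h : abs_summable A h -> rsum A (fun x => k * h x) = k * rsum A h.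
Proof.
move=> Ah.
wlog k0 : k / 0 <= k.
  move=> H; case: (leP 0 k) => k0; first exact: H.
  rewrite -[k]opprK mulNr -H ?oppr_ge0 ?ltW//.
  rewrite -rsumN; last exact: abs_summableZ.
  by apply: eq_rsum => x _; rewrite !mulNr.
have [Ahp Ahn] := (abs_summable_pos Ah, abs_summable_neg Ah).
have hp x : A x -> 0 <= pos_part h x by move=> _; exact: pos_part_ge0.
have hn x : A x -> 0 <= neg_part h x by move=> _; exact: neg_part_ge0.
transitivity (rsum A (fun x => k * pos_part h x - k * neg_part h x)).
  by apply: eq_rsum => x _; rewrite {1}(pos_partB h); ring.
have Akp := abs_summableZ k Ahp; have Akn := abs_summableZ k Ahn.
rewrite rsumD//; last first.
  by apply: abs_summable_le (abs_summable_abs Akn) => x _; rewrite normrN.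
rewrite rsumN// !rsumZ_ge0// (rsum_pos_neg Ah) -!rsum_ge0E//; ring.
Qed.

Lemma rsumB h g : abs_summable A h -> abs_summable A g ->
  rsum A (fun x => h x - g x) = rsum A h - rsum A g.
Proof.
move=> Ah Ag; rewrite rsumD ?rsumN//.
by apply: abs_summable_le (abs_summable_abs Ag) => x _; rewrite normrN.
Qed.

Lemma rsum0 : rsum A (fun=> 0 : R) = 0.
Proof. by rewrite rsum_ge0E//; [rewrite esum1|exact: abs_summable0]. Qed.

Lemma rsum_sum (I : Type) (r : seq I) (P : pred I) (F : I -> T -> R) :
  (forall i, P i -> abs_summable A (F i)) ->
  rsum A (fun x => \sum_(i <- r | P i) F i x) = \sum_(i <- r | P i) rsum A (F i).
Proof.
move=> FP; elim: r => [|i r IH].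
  by rewrite big_nil -[RHS]rsum0; apply: eq_rsum => x _; rewrite big_nil.
rewrite big_cons; case: ifPn => Pi; last first.
  by rewrite -IH; apply: eq_rsum => x _; rewrite big_cons (negPf Pi).
rewrite -IH -rsumD; [|exact: FP|exact: abs_summable_sum].
by apply: eq_rsum => x _; rewrite big_cons Pi.
Qed.

Lemma le_rsum h g : abs_summable A h -> abs_summable A g ->
  (forall x, A x -> h x <= g x) -> rsum A h <= rsum A g.
Proof.
move=> Ah Ag hg; rewrite -subr_ge0 -rsumB//; apply: rsum_ge0.
  by move=> x Ax; rewrite subr_ge0 hg.
apply: abs_summableD => //.
by apply: abs_summable_le (abs_summable_abs Ah) => x _; rewrite normrN.
Qed.

Lemma le_normr_rsum h : abs_summable A h -> `|rsum A h| <= rsum A (fun x => `|h x|).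
Proof.
move=> Ah; have Aa := abs_summable_abs Ah.
rewrite ler_norml -rsumN// !le_rsum//.
- by move=> x _; exact: ler_norm.
- by apply: abs_summable_le Aa => x _; rewrite normrN normr_id.
- by move=> x _; rewrite lerNl; apply: le_trans (ler_norm _) _; rewrite normrN.
Qed.

(** No summability is assumed: for a non-summable family the right-hand side is
    infinite, which is how the junk values of [rsum] are absorbed. *)
Lemma le_normr_rsum_esum h : (`|rsum A h|%:E <= \esum_(x in A) `|h x|%:E)%E.
Proof.
have [Ah|nAh] := pselect (abs_summable A h).
  rewrite -EFin_rsum//; last exact: abs_summable_abs.
  by rewrite lee_fin le_normr_rsum.
have -> : (\esum_(x in A) `|h x|%:E)%E = +oo%E; last exact: leey.
by apply/eqP/negPn/negP => H; apply: nAh; rewrite abs_summableE ltey.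
Qed.

End OneSet.

Lemma abs_summable_sub (T : choiceType) (A B : set T) (h : T -> R) :
  A `<=` B -> abs_summable B h -> abs_summable A h.
Proof.
move=> AB; apply: le_lt_trans; rewrite esum_mkcond [leRHS]esum_mkcond.
apply: le_esum => x _; case: ifPn => [/set_mem/AB/mem_set ->//|_].
by case: ifP.
Qed.

Lemma rsum_indic (T : choiceType) (A : set T) (h : T -> R) :
  rsum [set: T] (fun x => \1_A x * h x) = rsum A h.
Proof.
rewrite /rsum; congr (fine (_ - _)%E); rewrite [RHS]esum_mkcond; apply: eq_esum => x _.
  rewrite !funeposE /= indicE; case: ifP; rewrite ?mul1r ?mul0r//.
  by rewrite maxxx.
rewrite !funenegE /= indicE; case: ifP; rewrite ?mul1r ?mul0r//.
by rewrite oppr0 maxxx.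
Qed.

Lemma esum_fsetE (T : choiceType) (A : set T) (h : T -> R) :
  finite_set A -> (forall x, A x -> 0 <= h x) ->
  (\esum_(x in A) (h x)%:E = (\sum_(x <- fset_set A) h x)%:E)%E.
Proof.
move=> finA h0; rewrite esum_fset//; last by move=> x /set_mem Ax; rewrite lee_fin h0.
by rewrite fsbig_finite// sumEFin.
Qed.

Lemma abs_summable_finite (T : choiceType) (A : set T) (h : T -> R) :
  finite_set A -> abs_summable A h.
Proof.
by move=> finA; rewrite abs_summableE (esum_fsetE (h := fun x => `|h x|))// ltry.
Qed.

Lemma rsum_finite (T : choiceType) (A : set T) (h : T -> R) :
  finite_set A -> rsum A h = \sum_(x <- fset_set A) h x.
Proof.
move=> finA; rewrite rsum_pos_neg; last exact: abs_summable_finite.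
rewrite !esum_fsetE//; do ?by move=> x _; (exact: neg_part_ge0 || exact: pos_part_ge0).
by rewrite /= -sumrB; apply: eq_bigr => x _; rewrite -pos_partB.
Qed.

Lemma rsum_set1 (T : choiceType) (x : T) (h : T -> R) : rsum [set x] h = h x.
Proof. by rewrite rsum_finite// fset_set1 big_seq_fset1. Qed.

Section Partition.
Variables (I T : choiceType) (J : set I) (F : I -> set T).
Hypothesis trivF : trivIset J F.

Lemma esum_partition (h : T -> \bar R) : (forall x, 0 <= h x)%E ->
  (\esum_(x in \bigcup_(i in J) F i) h x = \esum_(i in J) \esum_(x in F i) h x)%E.
Proof.
move=> h0; rewrite esum_esum//; apply: reindex_esum => //; split.
- by move=> [/= i x] [Ji Fix]; exists i.
- move=> [/= i x] [/= j y]; rewrite ?inE/= => -[Ji Fx] [Jj Fy] xy.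
  congr (_, _) => //; apply: trivF => //; exists x; split => //.
  by rewrite xy.
- by move=> x [i Ji Fix]; exists (i, x).
Qed.

Variable h : T -> R.
Hypothesis sumh : abs_summable (\bigcup_(i in J) F i) h.

Let sumF i : J i -> abs_summable (F i) h.
Proof. by move=> Ji; apply: abs_summable_sub sumh; exact: bigcup_sup. Qed.

Lemma fine_esum_partition (g : T -> R) : (forall x, 0 <= g x) ->
   abs_summable (\bigcup_(i in J) F i) g ->
   let s i := fine (\esum_(x in F i) (g x)%:E) in
   [/\ abs_summable J s, forall i, 0 <= s i &
   (\esum_(x in \bigcup_(i in J) F i) (g x)%:E = \esum_(i in J) (s i)%:E)%E].
Proof.
move=> g0 sumg s.
have s0 i : 0 <= s i by apply: fine_ge0; apply: esum_ge0 => x _; rewrite lee_fin.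
have E : (\esum_(x in \bigcup_(i in J) F i) (g x)%:E = \esum_(i in J) (s i)%:E)%E.
  rewrite esum_partition; last by move=> x; rewrite lee_fin.
  apply: eq_esum => i Ji; rewrite fine_esumK//.
  by apply: abs_summable_sub sumg; exact: bigcup_sup.
split=> //; rewrite abs_summableE.
under eq_esum do rewrite ger0_norm//.
rewrite -E -fine_esumK ?ltry//.
Qed.

Lemma abs_summable_partition : abs_summable J (fun i => rsum (F i) h).
Proof.
have [Js _ _] := fine_esum_partition (fun x => normr_ge0 (h x)) (abs_summable_abs sumh).
apply: abs_summable_le Js => i Ji.
by rewrite -rsum_ge0E// ?le_normr_rsum//; [exact: sumF|exact/abs_summable_abs/sumF].
Qed.

Lemma rsum_partition :
  rsum (\bigcup_(i in J) F i) h = rsum J (fun i => rsum (F i) h).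
Proof.
have [Jp p0 Ep] := fine_esum_partition (pos_part_ge0 h) (abs_summable_pos sumh).
have [Jn n0 En] := fine_esum_partition (neg_part_ge0 h) (abs_summable_neg sumh).
rewrite rsum_pos_neg// Ep En -rsumB_ge0//.
by apply: eq_rsum => i Ji; rewrite rsum_pos_neg//; exact: sumF.
Qed.

End Partition.
End RealSums.
(** * The tree: parents, children and heights *)

Section RadialTree.
Variables (V : choiceType) (adj : rel V) (o : V).
Hypothesis treeV : is_tree adj.

Local Notation height := (height adj o).
Local Notation parent := (parent adj o).
Local Notation children := (children adj o).
Local Notation sector := (sector adj o).

Let adj_sym : symmetric adj. Proof. by case: treeV. Qed.
Let adj_irr : irreflexive adj. Proof. by case: treeV. Qed.

Lemma dist_spec x y : walk_lengths adj x y (dist adj x y) /\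
  forall m, walk_lengths adj x y m -> (dist adj x y <= m)%N.
Proof.
apply: (@xgetPex _ 0%N [set n | walk_lengths adj x y n /\
  forall m, walk_lengths adj x y m -> (n <= m)%N]).
have ex : exists n, `[< walk_lengths adj x y n >].
  case: treeV => _ _ /(_ x y)[p [pp lp]] _.
  by exists (size p); apply/asboolP; exists p.
exists (ex_minn ex); case: ex_minnP => n /asboolP wn mn; split=> // m wm.
by apply: mn; apply/asboolP.
Qed.

Lemma dist_walk x y :
  exists p, [/\ path adj x p, last x p = y & size p = dist adj x y].
Proof. by case: (dist_spec x y). Qed.

Lemma dist_le x p : path adj x p -> (dist adj x (last x p) <= size p)%N.
Proof. by move=> pp; case: (dist_spec x (last x p)) => _; apply; exists p. Qed.

Lemma dist_eq0 x y : dist adj x y = 0%N -> x = y.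
Proof. by move=> d0; case: (dist_walk x y) => -[|z p] [_ lp] //; rewrite d0. Qed.

Lemma neighboursE x y : neighbours adj x y <-> adj x y.
Proof.
rewrite /neighbours /=; split=> [d1|xy].
  case: (dist_walk x y) => -[|z [|? ?]]; rewrite d1 => -[//=].
  by rewrite andbT => xz <-.
have : (dist adj x y <= 1)%N by apply: (@dist_le x [:: y]); rewrite /= xy.
case E : (dist adj x y) => [|[|n]] //.
by move: xy; rewrite (dist_eq0 E) adj_irr.
Qed.

Lemma height_adj x y : adj x y -> (height x <= (height y).+1)%N.
Proof.
move=> xy; case: (dist_walk y o) => p [pp lp sp].
rewrite /Defs.height -sp -[in X in dist adj x X]lp.
by apply: (@dist_le x (y :: p)); rewrite /= xy.
Qed.

Lemma height_origin : height o = 0%N.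
Proof. by apply/eqP; rewrite -leqn0; apply: (@dist_le o [::]). Qed.

Lemma height_eq0 x : height x = 0%N -> x = o.
Proof. exact: dist_eq0. Qed.

Lemma lower_neighbour x : x <> o ->
  exists2 y, adj x y & height x = (height y).+1.
Proof.
move=> xo; case: (dist_walk x o) => -[|y p] /= [].
  by move=> _ /xo.
move=> /andP[xy pp] lp sp; exists y => //; apply/eqP.
rewrite eqn_leq height_adj// {2}/Defs.height -sp ltnS -lp.
exact: dist_le.
Qed.

Lemma low_walk x : exists p,
  [/\ path adj x p, last x p = o & all (fun z => height z <= height x)%N p].
Proof.
move: {2}(height x) (erefl (height x)) => n; elim: n x => [|n IH] x hx.
  by exists [::]; split=> //; exact: height_eq0.
have [|y xy hy] := @lower_neighbour x.
  by move=> xo; move: hx; rewrite xo height_origin.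
case: (IH y) => [|p [pp lp ap]]; first by move: hx; rewrite hy => -[].
exists (y :: p); split; rewrite /= ?xy//.
rewrite hy leqnSn /=; apply: sub_all ap => z; exact: leqW.
Qed.

(** Going down from [x] to the origin and up again to [y] never rises above the
    higher endpoint; removing the loops keeps this property.  Closing such a path
    through a higher vertex is what produces a forbidden cycle. *)
Lemma low_simple_path n x y : (height x <= n)%N -> (height y <= n)%N ->
  exists p, [/\ path adj x p, last x p = y, uniq (x :: p) &
                all (fun z => height z <= n)%N (x :: p)].
Proof.
move=> hx hy; case: (low_walk x) => p [pp lp ap]; case: (low_walk y) => r [pr lr ar].
have pw : path adj x (p ++ rev (belast y r)).
  rewrite cat_path pp lp -lr rev_path /=.
  by under eq_path do rewrite adj_sym.
have lw : last x (p ++ rev (belast y r)) = y.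
  rewrite last_cat lp; case: r lr {ar pr pw} => [|z r] // _.
  by rewrite /= rev_cons last_rcons.
have aw z : z \in x :: p ++ rev (belast y r) -> (height z <= n)%N.
  rewrite inE mem_cat mem_rev => /or3P[/eqP->//|zp|/mem_belast].
    exact: leq_trans (allP ap _ zp) hx.
  rewrite inE => /orP[/eqP->//|zr]; exact: leq_trans (allP ar _ zr) hy.
case: (shortenP pw) lw => p' pp' up' sub lw; exists p'; split=> //.
apply/allP => z; rewrite inE => /orP[/eqP->//|zp]; apply: aw.
by rewrite inE sub ?orbT.
Qed.

(** If [x] and [y] were adjacent at the same height, a simple path below them
    between lower neighbours of each would close into a cycle through [x] and [y]. *)
Lemma adj_height_neq x y : adj x y -> height x <> height y.
Proof.
move=> xy hxy.
have nxy : x <> y by move=> e; move: xy; rewrite e adj_irr.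
have hx0 : x <> o.
  move=> e; apply: nxy; rewrite e; apply/esym/height_eq0.
  by rewrite -hxy e height_origin.
have hy0 : y <> o.
  move=> e; apply: nxy; rewrite e; apply: height_eq0.
  by rewrite hxy e height_origin.
case: (lower_neighbour hx0) => x' xx' hx'; case: (lower_neighbour hy0) => y' yy' hy'.
have hy'x' : height y' = height x' by apply: succn_inj; rewrite -hy' -hx'.
have [p [pp lp up ap]] := @low_simple_path (height x') x' y' (leqnn _) (eq_leq hy'x').
have notin z : height z = (height x').+1 -> z \notin x' :: p.
  by move=> hz; apply/negP => /(allP ap); rewrite hz ltnn.
case: treeV => _ _ _ /(_ (x :: rcons (x' :: p) y)) H.
suff : (size (x :: rcons (x' :: p) y) < 3)%N by rewrite /= size_rcons.
apply: H.
  rewrite cons_uniq rcons_uniq up andbT mem_rcons in_cons negb_or.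
  by rewrite !notin// -?hxy// !andbT; apply/eqP.
by rewrite /= xx' !rcons_path pp !last_rcons lp adj_sym yy' adj_sym xy.
Qed.

(** Two lower neighbours of [x] are joined by a simple path that stays below [x];
    adding [x] closes it into a cycle. *)
Lemma lower_neighbour_unique x y z : adj x y -> adj x z ->
  height x = (height y).+1 -> height x = (height z).+1 -> y = z.
Proof.
move=> xy xz hy hz; apply: contrapT => nyz.
have hzy : height z = height y by apply: succn_inj; rewrite -hz -hy.
have [p [pp lp up ap]] := @low_simple_path (height y) y z (leqnn _) (eq_leq hzy).
case: treeV => _ _ _ /(_ (x :: y :: p)) H.
suff : (size (x :: y :: p) < 3)%N.
  by case: p {H} lp {pp up ap} => //= yz; case: nyz.
apply: H.
  rewrite cons_uniq up andbT; apply/negP => /(allP ap).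
  by rewrite hy ltnn.
by rewrite /= xy rcons_path pp lp adj_sym xz.
Qed.

Lemma parentP x : x <> o -> adj x (parent x) /\ height x = (height (parent x)).+1.
Proof.
move=> xo; case: (lower_neighbour xo) => y xy hy.
have [] := @xgetPex _ x [set y | neighbours adj x y /\ height x = (height y).+1].
  by exists y; split=> //; apply/neighboursE.
by move=> /neighboursE.
Qed.

Lemma parent_eq x y : adj x y -> height x = (height y).+1 -> parent x = y.
Proof.
move=> xy hy; have xo : x <> o by move=> e; move: hy; rewrite e height_origin.
by case: (parentP xo) => xp hp; exact: (lower_neighbour_unique xp xy hp hy).
Qed.

Lemma parent_origin : parent o = o.
Proof. by apply: xgetPN => y [_]; rewrite height_origin. Qed.

Lemma height_parent x : height (parent x) = (height x).-1.
Proof.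
have [->|/eqP xo] := eqVneq x o; first by rewrite parent_origin height_origin.
by case: (parentP xo) => _ ->.
Qed.

Lemma childrenE x y : children x y <-> y <> o /\ parent y = x.
Proof.
split=> [[/neighboursE xy hy]|[yo <-]].
  split; last by apply: parent_eq; rewrite // adj_sym.
  by move=> e; move: hy; rewrite e height_origin.
by case: (parentP yo) => yp hy; split=> //; apply/neighboursE; rewrite adj_sym.
Qed.

Lemma neighbours_childrenP x y :
  neighbours adj x y <-> children x y \/ (x <> o /\ y = parent x).
Proof.
split=> [/neighboursE xy|[[]//|[xo ->]]]; last first.
  by apply/neighboursE; case: (parentP xo).
have yx : adj y x by rewrite adj_sym.
have := height_adj xy; have := height_adj yx; have := adj_height_neq xy.
case: (ltngtP (height x) (height y)) => // h _ h1 h2.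
  left; split; first exact/neighboursE.
  by apply/eqP; rewrite eqn_leq h h1.
right; have hx : height x = (height y).+1 by apply/eqP; rewrite eqn_leq h2 h.
split; first by move=> e; move: hx; rewrite e height_origin.
by rewrite (parent_eq xy hx).
Qed.

(** * Ancestors, sectors and sums over the descendants of a vertex *)

(** For [k > height x] this is [x] itself. *)
Definition ancestor (x : V) (k : nat) : V := iter (height x - k) parent x.

Definition descendants (n : nat) (x : V) : set V :=
  [set y | iter n parent y = x /\ height y = (height x + n)%N].

Lemma height_iter_parent n x : height (iter n parent x) = (height x - n)%N.
Proof. by elim: n => [|n IH] /=; rewrite ?subn0// height_parent IH subnS. Qed.

Lemma iter_parent_origin n : iter n parent o = o.
Proof. by elim: n => //= n ->; exact: parent_origin. Qed.

Lemma height_gt0 x : x <> o -> (0 < height x)%N.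
Proof. by move=> xo; case: (parentP xo) => _ ->. Qed.

Lemma height_children x y : children x y -> height y = (height x).+1.
Proof. by case. Qed.

Lemma parent_children x y : children x y -> parent y = x.
Proof. by move=> /childrenE[]. Qed.

Lemma height_ancestor x k : (k <= height x)%N -> height (ancestor x k) = k.
Proof. by move=> kx; rewrite height_iter_parent subKn. Qed.

Lemma ancestor_height x : ancestor x (height x) = x.
Proof. by rewrite /ancestor subnn. Qed.

Lemma ancestor0 x : ancestor x 0 = o.
Proof. by apply: height_eq0; rewrite height_ancestor. Qed.

Lemma parent_ancestor x k : (k < height x)%N ->
  parent (ancestor x k.+1) = ancestor x k.
Proof. by move=> kx; rewrite /ancestor -iterS subnSK. Qed.

Lemma children_ancestor x k : (k < height x)%N ->
  children (ancestor x k) (ancestor x k.+1).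
Proof.
move=> kx; apply/childrenE; split; last exact: parent_ancestor.
by move=> e; have := height_ancestor kx; rewrite e height_origin.
Qed.

Lemma ancestor_children x y k : children x y -> (k <= height x)%N ->
  ancestor y k = ancestor x k.
Proof.
move=> xy kx; rewrite /ancestor (height_children xy) subSn// iterSr.
by rewrite (parent_children xy).
Qed.

(** The exponent in the definition of a sector is not unique when [x] is the
    origin; comparing heights selects a canonical one. *)
Lemma sectorE x y :
  sector x y <-> (height x <= height y)%N /\ ancestor y (height x) = x.
Proof.
split=> [[k <-]|[_ <-]]; last by exists (height y - height x)%N.
rewrite height_iter_parent leq_subr; split=> //; rewrite /ancestor.
have [ky|/ltnW yk] := leqP k (height y); first by rewrite subKn.
rewrite (eqP yk) subn0 -(subnKC yk) addnC iterD.
have -> : iter (height y) parent y = o.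
  by apply: height_eq0; rewrite height_iter_parent subnn.
by rewrite iter_parent_origin.
Qed.

Lemma sector_self x : sector x x. Proof. by exists 0%N. Qed.

Lemma sector_ancestor x k : sector (ancestor x k) x.
Proof. by exists (height x - k)%N. Qed.

Lemma sector_origin : sector o = [set: V].
Proof.
apply/seteqP; split=> // x _; apply/sectorE.
by rewrite height_origin ancestor0.
Qed.

Lemma sector_height_le x y : sector x y -> (height x <= height y)%N.
Proof. by move=> /sectorE[]. Qed.

Lemma sector_inj x y : sector x = sector y -> x = y.
Proof.
move=> xy; have /sectorE[yx _] : sector y x by rewrite -xy; exact: sector_self.
have /sectorE[xy' <-] : sector x y by rewrite xy; exact: sector_self.
by have -> : height x = height y; [apply/eqP; rewrite eqn_leq xy' yx|exact: ancestor_height].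
Qed.

Lemma sector_vertexE x : sector_vertex adj o (sector x) = x.
Proof. by apply: xget_unique => // y /sector_inj ->. Qed.

Lemma descendants0 x : descendants 0 x = [set x].
Proof.
apply/seteqP; split=> y /=; first by case.
by move=> ->; split; rewrite ?addn0.
Qed.

Lemma descendantsS n x :
  descendants n.+1 x = \bigcup_(v in children x) descendants n v.
Proof.
apply/seteqP; split=> y /=.
  move=> [yx hy]; have hv : height (iter n parent y) = (height x).+1.
    by rewrite height_iter_parent hy addnS -addSn addnK.
  exists (iter n parent y); last by split=> //; rewrite hv hy addnS addSn.
  apply/childrenE; split=> // e.
  by move: hv; rewrite e height_origin.
move=> [v xv [yv hy]]; split; first by rewrite /= yv (parent_children xv).
by rewrite hy (height_children xv) addnS addSn.
Qed.

Lemma trivIset_descendants_vertex n (A : set V) : trivIset A (descendants n).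
Proof. by move=> x y _ _ [z [[<- _] [<- _]]]. Qed.

Lemma trivIset_descendants_level x (A : set nat) :
  trivIset A (fun n => descendants n x).
Proof. by move=> n m _ _ [z [[_ hz] [_]]]; rewrite hz => /addnI. Qed.

Lemma sector_descendants x : sector x = \bigcup_n descendants n x.
Proof.
apply/seteqP; split=> y; last by move=> [n _ [yx _]]; exists n.
move=> /sectorE[xy yx]; exists (height y - height x)%N => //.
by split=> //; rewrite subnKC.
Qed.

Variable q : nat -> nat.
Hypothesis radV : radial adj o q.

Let finite_children x : finite_set (children x). Proof. by case: (radV x). Qed.

Lemma finite_descendants n x : finite_set (descendants n x).
Proof.
elim: n x => [|n IH] x; first by rewrite descendants0.
by rewrite descendantsS; exact: bigcup_finite.
Qed.

Variable R : realType.
Implicit Types (f g h : V -> R).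

(** Its [n]-th iterate sums a function over the [n]-th generation below a vertex,
    so that sums over sectors become series of real numbers. *)
Definition child_sum g (x : V) : R := \sum_(y <- fset_set (children x)) g y.

Lemma mem_children x y : (y \in fset_set (children x)) <-> children x y.
Proof. by rewrite in_fset_set// inE. Qed.

Lemma eq_child_sum f g x : (forall y, children x y -> f y = g y) ->
  child_sum f x = child_sum g x.
Proof.
move=> fg; rewrite /child_sum big_seq [RHS]big_seq; apply: eq_bigr => y.
by move=> /mem_children; exact: fg.
Qed.

Lemma child_sumD f g x : child_sum (fun y => f y + g y) x = child_sum f x + child_sum g x.
Proof. exact: big_split. Qed.

Lemma child_sumZ k f x : child_sum (fun y => k * f y) x = k * child_sum f x.
Proof. by rewrite /child_sum mulr_sumr. Qed.

Lemma child_sum_const (k : R) x :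
  child_sum (fun=> k) x = (q (height x))%:R * k.
Proof.
case: (radV x) => _ <-; by rewrite /child_sum big_const_seq count_predT iter_addr_0 mulr_natl.
Qed.

Lemma rsum_descendants n x h : rsum (descendants n x) h = iter n child_sum h x.
Proof.
elim: n x => [|n IH] x; first by rewrite descendants0 rsum_set1.
rewrite descendantsS rsum_partition.
- by rewrite rsum_finite//; apply: eq_bigr => v _; exact: IH.
- exact: trivIset_descendants_vertex.
- by rewrite -descendantsS; apply: abs_summable_finite; exact: finite_descendants.
Qed.

Lemma rsum_sector x h : abs_summable (sector x) h ->
  rsum (sector x) h = rsum [set: nat] (fun n => iter n child_sum h x).
Proof.
rewrite sector_descendants => sh; rewrite rsum_partition//; last first.
  exact: trivIset_descendants_level.
by apply: eq_rsum => n _; exact: rsum_descendants.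
Qed.

Lemma abs_summable_levels x h : abs_summable (sector x) h ->
  abs_summable [set: nat] (fun n => iter n child_sum h x).
Proof.
rewrite sector_descendants => sh.
apply: abs_summable_eq (abs_summable_partition _ sh).
  by move=> n _; rewrite rsum_descendants.
exact: trivIset_descendants_level.
Qed.

Lemma indic_sector_children x y : (height x < height y)%N ->
  \1_(sector x) y = child_sum (fun v => \1_(sector v) y) x :> R.
Proof.
move=> xy; have [yx|nyx] := boolP (y \in sector x); last first.
  rewrite indicE (negPf nyx) /child_sum big_seq big1// => v /mem_children xv.
  rewrite indicE; case: (boolP (y \in sector v)) => // /set_mem[k kv].
  move: nyx; rewrite notin_setE => -[]; exists k.+1.
  by rewrite /= kv (parent_children xv).
have /sectorE[_ ax] := set_mem yx.
have xu : children x (ancestor y (height x).+1).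
  by rewrite -{1}ax; exact: children_ancestor.
rewrite indicE yx /child_sum (bigD1_seq _ (_ : ancestor y (height x).+1 \in _))/=.
- rewrite indicE mem_set; last exact: sector_ancestor.
  rewrite big_seq_cond big1 ?addr0// => v /andP[/mem_children xv vu].
  rewrite indicE memNset// => /sectorE[_].
  by rewrite (height_children xv) => e; move: vu; rewrite e eqxx.
- exact/mem_children.
- exact: fset_uniq.
Qed.

(** * The radial harmonic profile *)

Hypothesis q_ge2 : forall n, (2 <= q n)%N.

Let q_neq0 n : (q n)%:R != 0 :> R.
Proof. by rewrite pnatr_eq0; case: (q n) (q_ge2 n). Qed.

Let q_gt0 n : 0 < (q n)%:R :> R.
Proof. by rewrite lt_neqAle eq_sym q_neq0 ler0n. Qed.

Let q_ge0 n : 0 <= (q n)%:R^-1 :> R.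
Proof. by rewrite invr_ge0 ler0n. Qed.

(** The radial harmonic function below height [k] with [phi k k = 0] and
    [phi k k.+1 = 1]: harmonicity divides its increment by the number of children
    at each level, whence the partial products. *)
Definition phi (k n : nat) : R :=
  \sum_(k <= j < n) \prod_(k.+1 <= l < j.+1) (q l)%:R^-1.

Lemma phi_small k n : (n <= k)%N -> phi k n = 0.
Proof. by move=> nk; rewrite /phi big_geq. Qed.

(** Peeling off the first increment expresses the profile from height [k] by the
    one from height [k + 1]; this is the form used in all inductions. *)
Lemma phi_recl k n : (k < n)%N -> phi k n = 1 + (q k.+1)%:R^-1 * phi k.+1 n.
Proof.
move=> kn; rewrite /phi big_ltn// big_geq// mulr_sumr; congr (_ + _).
rewrite !big_nat; apply: eq_bigr => j /andP[kj _].
by rewrite big_ltn// ltnS.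
Qed.

Lemma phi_succ k : phi k k.+1 = 1.
Proof. by rewrite phi_recl// phi_small// mulr0 addr0. Qed.

Lemma phi_harmonic k n : (k < n)%N ->
  (q n)%:R * phi k n.+1 = (q n)%:R * phi k n + (phi k n - phi k n.-1).
Proof.
case: n => // n; rewrite ltnS => kn /=.
have phiS m : (k <= m)%N ->
    phi k m.+1 = phi k m + \prod_(k.+1 <= l < m.+1) (q l)%:R^-1.
  by move=> km; rewrite /phi big_nat_recr.
rewrite [phi k n.+2]phiS ?leqW// [in RHS]phiS// [in LHS]phiS//.
rewrite [X in _ + _ + X]big_nat_recr//=; have := q_neq0 n.+1 => q0; field.
by rewrite q0.
Qed.

Lemma phi_ge0 k n : 0 <= phi k n.
Proof. by apply: sumr_ge0 => j _; apply: prodr_ge0. Qed.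

Lemma phi_ge1 k n : (k < n)%N -> 1 <= phi k n.
Proof. by move=> kn; rewrite phi_recl// lerDl mulr_ge0// phi_ge0. Qed.

(** By [phi_recl], since 1 + 2 / q <= 2 when q >= 2. *)
Lemma phi_le2 k n : phi k n <= 2.
Proof.
move: {2}(n - k)%N (leqnn (n - k)%N) => d; elim: d k => [|d IH] k.
  by rewrite leqn0 subn_eq0 => nk; rewrite phi_small.
move=> nkd; case: (ltnP k n) => kn; last by rewrite phi_small.
rewrite phi_recl// (_ : 2 = 1 + 2^-1 * 2) ?lerD2l; last by rewrite mulVf// -natr1; lra.
apply: ler_pM => //; first exact: phi_ge0.
  by rewrite lef_pV2 ?posrE// ler_nat.
by apply: IH; rewrite subnS; lia.
Qed.

Definition level_count (k n : nat) : R := \prod_(l < n) (q (k + l))%:R.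

Lemma level_count_ge0 k n : 0 <= level_count k n.
Proof. by apply: prodr_ge0 => l _; rewrite ler0n. Qed.

Lemma level_countS k n : level_count k n.+1 = (q k)%:R * level_count k.+1 n.
Proof.
rewrite /level_count big_ord_recl addn0; congr (_ * _).
by apply: eq_bigr => l _; rewrite /bump /= addnS addSn.
Qed.

Lemma iter_child_sum_cst n (a : R) x :
  iter n child_sum (fun=> a) x = level_count (height x) n * a.
Proof.
elim: n x => [|n IH] x; first by rewrite /level_count big_ord0 mul1r.
rewrite iterS; under eq_child_sum => y xy do rewrite IH (height_children xy).
by rewrite child_sum_const level_countS mulrA.
Qed.

Lemma iter_child_sum_radial n (g : nat -> R) h x :
  iter n child_sum (fun y => g (height y) * h y) x =
  g (height x + n)%N * iter n child_sum h x.
Proof.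
elim: n x => [|n IH] x; first by rewrite addn0.
rewrite !iterS; under eq_child_sum => y xy do
  rewrite IH (height_children xy) addSn -addnS.
by rewrite child_sumZ.
Qed.

(** With the convention that the origin is its own parent, the mean value
    property takes the same form at the origin and at the other vertices. *)
Lemma harmonicP f : Defs.harmonic adj f <-> forall x,
  child_sum f x = (q (height x))%:R * f x + (f x - f (parent x)).
Proof.
have E x : \sum_(y \in neighbours adj x) f y =
    child_sum f x + (if x == o then 0 else f (parent x)) /\
    #|` fset_set (neighbours adj x)| = (q (height x) + (x != o))%N.
  have [finch chq] := radV x; have [->|/eqP xo] := eqVneq x o.
    have -> : neighbours adj o = children o.
      by apply/seteqP; split=> y => [/neighbours_childrenP[//|[]//]|[]].
    by have [fo co] := radV o; rewrite fsbig_finite// addr0 addn0.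
  have E : fset_set (neighbours adj x) = (parent x |` fset_set (children x))%fset.
    rewrite -(set_fsetK (_ |` _)%fset); congr fset_set.
    apply/seteqP; split=> y /=.
      move=> /neighbours_childrenP[xy|[_ ->]]; rewrite !inE ?eqxx//.
      by rewrite in_fset_set// mem_set// orbT.
    rewrite !inE => /orP[/eqP->|yx]; apply/neighbours_childrenP; first by right.
    by left; exact/mem_children.
  have np : (parent x \notin fset_set (children x)).
    apply/negP => /mem_children/height_children; rewrite height_parent.
    by have := height_gt0 xo; lia.
  have finN : finite_set (neighbours adj x).
    apply: (@sub_finite_set _ _ [set` (parent x |` fset_set (children x))%fset]) => //.
    move=> y /neighbours_childrenP[xy|[_ ->]] /=; rewrite !inE ?eqxx//.
    by rewrite in_fset_set// mem_set// orbT.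
  rewrite fsbig_finite// E big_fsetU1//= cardfsU1 np addrC -chq; split=> //.
  by rewrite addnC.
have D x : (#|` fset_set (neighbours adj x)|%:R : R) = (q (height x))%:R + (x != o)%:R.
  by rewrite (E x).2 natrD.
split=> H x; have := H x; rewrite /laplacian D (E x).1.
  have [->|xo] := eqVneq x o; rewrite ?addr0 ?parent_origin => /eqP;
    rewrite subr_eq0 => /eqP e.
    by rewrite subrr addr0 [in RHS]e mulVKf.
  have q1 : (q (height x))%:R + 1 != 0 :> R by rewrite natr1 pnatr_eq0.
  apply/eqP; rewrite -subr_eq0; apply/eqP; move: e => /(congr1 (fun t => ((q (height x))%:R + 1) * t)).
  by rewrite mulVKf// => e; rewrite mulrDl in e; lra.
have [->|xo] := eqVneq x o; rewrite ?addr0 ?parent_origin => ->.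
  by rewrite subrr addr0 mulKf// subrr.
have q1 : (q (height x))%:R + 1 != 0 :> R by rewrite natr1 pnatr_eq0.
by rewrite /=; field.
Qed.

(** The level sums below [y] of a harmonic function satisfy the recurrence of
    [phi], with initial values at [parent y] and [y]; so they depend on the
    function through these two values only.  At the origin, where the two
    coincide, the level averages are constant. *)
Lemma iter_child_sum_harmonic n f y : Defs.harmonic adj f ->
  iter n child_sum f y = level_count (height y) n *
    (f (parent y) + (f y - f (parent y)) * phi (height y).-1 (height y + n)).
Proof.
move=> /harmonicP harm; elim: n y => [|n IH] y.
  rewrite /= addn0 /level_count big_ord0 mul1r.
  have [->|/eqP yo] := eqVneq y o; first by rewrite parent_origin subrr mul0r addr0.
  have := height_gt0 yo; case: (height y) => //= k _.
  by rewrite phi_succ; ring.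
rewrite iterS.
have -> : child_sum (iter n child_sum f) y = child_sum (fun u =>
    level_count (height y).+1 n * (f y * (1 - phi (height y) (height y + n.+1)) +
       phi (height y) (height y + n.+1) * f u)) y.
  apply: eq_child_sum => u yu; rewrite IH (height_children yu) (parent_children yu).
  by rewrite /= addSn -addnS; ring.
rewrite child_sumZ child_sumD child_sum_const child_sumZ harm level_countS.
set P := phi (height y) _; have Q0 := q_neq0 (height y).
have [->|/eqP yo] := eqVneq y o.
  by rewrite parent_origin; ring.
have -> : phi (height y).-1 (height y + n.+1) = 1 + (q (height y))%:R^-1 * P.
  by rewrite phi_recl prednK// ?height_gt0//; lia.
by field.
Qed.

(** * The measure *)

Variables (alpha c : R).
Hypotheses (alpha_gt1 : 1 < alpha) (c_gt0 : 0 < c).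
Local Notation w := (weight adj o q alpha c).
Hypothesis mass1 : mass w [set: V] = 1%E.

Definition level_weight (n : nat) : R := c * \prod_(l < n) (q l)%:R `^ (- alpha).

Lemma level_weight_gt0 n : 0 < level_weight n.
Proof. by apply: mulr_gt0 => //; apply: prodr_gt0 => l _; exact: powR_gt0. Qed.

Lemma weight_gt0 x : 0 < w x. Proof. exact: level_weight_gt0. Qed.

Lemma weight_ge0 x : 0 <= w x. Proof. exact/ltW/weight_gt0. Qed.

Lemma abs_summable_weight A : abs_summable A w.
Proof.
apply: (@abs_summable_sub _ _ _ [set: V]) => //.
rewrite abs_summableE; under eq_esum do rewrite ger0_norm ?weight_ge0//.
by rewrite -/(mass w [set: V]) mass1 ltry.
Qed.

Lemma abs_summable_bounded (T : choiceType) (A : set T) (g h : T -> R) B :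
  (forall x, A x -> `|g x| <= B) -> abs_summable A h ->
  abs_summable A (fun x => g x * h x).
Proof.
move=> gB /abs_summable_abs /(abs_summableZ B); apply: abs_summable_le => x Ax.
by rewrite normrM ler_wpM2r// gB.
Qed.

Definition sector_mass x : R := rsum (sector x) w.

Lemma sector_massE x : mass w (sector x) = (sector_mass x)%:E.
Proof.
rewrite /sector_mass EFin_rsum//; last exact: abs_summable_weight.
by move=> y _; exact: weight_ge0.
Qed.

Lemma iter_child_sum_weighted n (g : nat -> R) f x :
  iter n child_sum (fun y => g (height y) * f y * w y) x =
  g (height x + n)%N * level_weight (height x + n)%N * iter n child_sum f x.
Proof.
rewrite -(iter_child_sum_radial n (fun m => g m * level_weight m)).
by congr (iter n child_sum _ x); apply/funext => y; rewrite mulrAC.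
Qed.

Lemma iter_child_sum_weight n x :
  iter n child_sum w x = level_count (height x) n * level_weight (height x + n).
Proof.
have -> : iter n child_sum w x = iter n child_sum (fun y => 1 * 1 * w y) x.
  by congr (iter n child_sum _ x); apply/funext => y; rewrite !mul1r.
rewrite (iter_child_sum_weighted n (fun=> 1) (fun=> 1)) iter_child_sum_cst.
by rewrite mul1r mulr1 mulrC.
Qed.

Lemma sector_mass_levels x : sector_mass x =
  rsum [set: nat] (fun n => level_count (height x) n * level_weight (height x + n)).
Proof.
rewrite /sector_mass rsum_sector; last exact: abs_summable_weight.
by apply: eq_rsum => n _; exact: iter_child_sum_weight.
Qed.

Lemma eq_sector_mass x y : height x = height y -> sector_mass x = sector_mass y.
Proof. by rewrite !sector_mass_levels => ->. Qed.

Lemma sector_mass_gt0 x : 0 < sector_mass x.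
Proof.
apply: lt_le_trans (weight_gt0 x) _.
rewrite -(rsum_set1 x w) -rsum_indic /sector_mass -[leRHS]rsum_indic.
have I A : abs_summable [set: V] (fun y => \1_A y * w y).
  apply: (@abs_summable_bounded _ _ _ _ 1); last exact: abs_summable_weight.
  by move=> y _; rewrite indicE; case: (_ \in _); rewrite ?normr1 ?normr0.
apply: le_rsum => // y _; apply: ler_wpM2r; first exact: weight_ge0.
rewrite !indicE; case: (boolP (y \in [set x])) => // /set_mem ->.
by rewrite mem_set//; exact: sector_self.
Qed.

(** The integral of the [p]-th power of [phi k] over the sector of any vertex of
    height [k + 1] ([phi_momentE]), written as a series over the levels so that it
    visibly depends on [k] only. *)
Definition phi_moment (p k : nat) : R :=
  rsum [set: nat] (fun n => level_count k.+1 n *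
    (phi k (k.+1 + n) ^+ p * level_weight (k.+1 + n))).

Lemma phi_pow_bound p k n : `|phi k n ^+ p| <= 2 ^+ p.
Proof. by rewrite ger0_norm ?exprn_ge0 ?phi_ge0// lerXn2r ?nnegrE ?phi_ge0// phi_le2. Qed.

Lemma phi_momentE p k u : height u = k.+1 ->
  abs_summable [set: nat] (fun n => level_count k.+1 n *
    (phi k (k.+1 + n) ^+ p * level_weight (k.+1 + n))) /\
  phi_moment p k = rsum (sector u) (fun y => phi k (height y) ^+ p * w y).
Proof.
move=> hu.
have E n : level_count k.+1 n * (phi k (k.+1 + n) ^+ p * level_weight (k.+1 + n)) =
    iter n child_sum (fun y => phi k (height y) ^+ p * w y) u.
  transitivity (iter n child_sum (fun y => phi k (height y) ^+ p * 1 * w y) u).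
    rewrite (iter_child_sum_weighted n (fun m => phi k m ^+ p) (fun=> 1)).
    by rewrite iter_child_sum_cst mulr1 hu mulrC.
  by congr (iter n child_sum _ u); apply/funext => y; rewrite mulr1.
have S : abs_summable (sector u) (fun y => phi k (height y) ^+ p * w y).
  apply: abs_summable_bounded (abs_summable_weight _) => y _.
  exact: phi_pow_bound.
split; first by apply: abs_summable_eq (abs_summable_levels S) => n _.
by rewrite rsum_sector//; apply: eq_rsum => n _.
Qed.

Lemma le_sector_mass_phi_moment u k : height u = k.+1 ->
  sector_mass u <= phi_moment 2 k.
Proof.
move=> hu; have [_ ->] := phi_momentE 2 hu; apply: le_rsum.
- exact: abs_summable_weight.
- apply: abs_summable_bounded (abs_summable_weight _) => y _.
  exact: phi_pow_bound.
move=> y /sector_height_le; rewrite hu => hy.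
by rewrite ler_peMl ?weight_ge0// expr_ge1 ?phi_ge0// phi_ge1.
Qed.

(** The moment of order 1 appears with the coefficient [f (parent u)], which is
    the same for all siblings of [u]: it disappears from the differences formed by
    the kernel, and the moment of order 2 is the norm that normalizes the kernel. *)
Lemma rsum_sector_harmonic f u k : Defs.harmonic adj f ->
  abs_summable [set: V] (fun y => f y * w y) -> height u = k.+1 ->
  rsum (sector u) (fun y => phi k (height y) * f y * w y) =
  f (parent u) * phi_moment 1 k + (f u - f (parent u)) * phi_moment 2 k.
Proof.
move=> harm fw hu; have [S1 _] := phi_momentE 1 hu; have [S2 _] := phi_momentE 2 hu.
rewrite rsum_sector; last first.
  apply: (@abs_summable_sub _ _ _ [set: V]) => //.
  have : abs_summable [set: V] (fun y => phi k (height y) ^+ 1 * (f y * w y)).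
    by apply: abs_summable_bounded fw => y _; exact: phi_pow_bound.
  by apply: abs_summable_eq => y _; rewrite mulrA.
rewrite -!rsumZ// -rsumD; do ?by exact: abs_summableZ.
apply: eq_rsum => n _.
rewrite iter_child_sum_weighted iter_child_sum_harmonic// hu /=; ring.
Qed.

(** * The reproducing kernel *)

Lemma indic_bound (T : Type) (A : set T) (y : T) : `|\1_A y| <= 1 :> R.
Proof. by rewrite indicE; case: (_ \in _); rewrite ?normr1 ?normr0. Qed.

Lemma abs_summable_indic (A B : set V) h : abs_summable B h ->
  abs_summable B (fun y => \1_A y * h y).
Proof. by apply: abs_summable_bounded => y _; exact: indic_bound. Qed.

Lemma rsum_harmonic f : Defs.harmonic adj f ->
  abs_summable [set: V] (fun y => f y * w y) ->
  rsum [set: V] (fun y => f y * w y) = f o.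
Proof.
move=> harm fw; have := sector_mass_levels o.
have -> : sector_mass o = 1.
  by apply: EFin_inj; rewrite -sector_massE sector_origin.
rewrite height_origin => mE.
rewrite -sector_origin rsum_sector ?sector_origin// -[RHS]mulr1 mE -rsumZ; last first.
  have := @abs_summable_levels o w (abs_summable_weight _).
  apply: abs_summable_eq => n _.
  by rewrite iter_child_sum_weight height_origin.
apply: eq_rsum => n _.
have -> : iter n child_sum (fun y => f y * w y) o =
          iter n child_sum (fun y => 1 * f y * w y) o.
  by congr (iter n child_sum _ o); apply/funext => y; rewrite mul1r.
rewrite (iter_child_sum_weighted n (fun=> 1)) iter_child_sum_harmonic//.
by rewrite height_origin parent_origin; ring.
Qed.

(** The reproducing kernel of the piece of the Bergman space attached to the
    ancestor of [x] at height [k].  The factor [phi k (height y)] vanishes unless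
    [y] lies strictly above height [k], so the second indicator does not see the
    vertex [ancestor x k] itself. *)
Definition kernel_term (x : V) (k : nat) (y : V) : R :=
  (phi_moment 2 k)^-1 * phi k (height x) * phi k (height y) *
  (\1_(sector (ancestor x k.+1)) y - (q k)%:R^-1 * \1_(sector (ancestor x k)) y).

Definition kernel (x y : V) : R :=
  1 + \sum_(0 <= k < height x) kernel_term x k y.

Lemma phi_moment_gt0 x k : (k < height x)%N -> 0 < phi_moment 2 k.
Proof.
move=> kx; apply: lt_le_trans (sector_mass_gt0 (ancestor x k.+1)) _.
by apply: le_sector_mass_phi_moment; rewrite height_ancestor.
Qed.

Lemma indic_sector_height u y : (height u <= height y)%N ->
  \1_(sector u) y = (ancestor y (height u) == u)%:R :> R.
Proof.
move=> uy; rewrite indicE; congr (nat_of_bool _)%:R.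
by apply/idP/eqP => [/set_mem/sectorE[]|e] //; apply/mem_set/sectorE.
Qed.

Lemma indic_sector_child u y v : children y v -> (height u <= height y)%N ->
  \1_(sector u) v = \1_(sector u) y :> R.
Proof.
move=> yv uy; rewrite !indic_sector_height ?(height_children yv) ?leqW//.
by rewrite (ancestor_children yv).
Qed.

Lemma indic_sector_sym u v : height u = height v ->
  \1_(sector u) v = \1_(sector v) u :> R.
Proof.
move=> uv; rewrite !indic_sector_height ?uv// -{1}uv.
by rewrite {1}uv !ancestor_height -uv ancestor_height eq_sym.
Qed.

Lemma kernel_termC x y k : (k < height x)%N -> (k < height y)%N ->
  kernel_term x k y = kernel_term y k x.
Proof.
move=> kx ky; rewrite /kernel_term !indic_sector_height ?height_ancestor//; try exact: ltnW.
by rewrite [ancestor y k == _]eq_sym [ancestor y k.+1 == _]eq_sym [X in X * _ = _]mulrAC.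
Qed.

(** The sum stops at the height of [x], but the terms between the two heights
    vanish. *)
Lemma kernelC x y : kernel x y = kernel y x.
Proof.
wlog xy : x y / (height x <= height y)%N.
  by move=> H; case/orP: (leq_total (height x) (height y)) => /H.
rewrite /kernel [in RHS](big_cat_nat (n := height x))//=; congr (_ + _).
rewrite [X in _ = _ + X]big_nat [X in _ = _ + X]big1 ?addr0; last first.
  by move=> k /andP[xk _]; rewrite /kernel_term (phi_small xk) mulr0 mul0r.
rewrite !big_nat; apply: eq_bigr => k /andP[_ kx]; apply: kernel_termC => //.
exact: leq_trans kx xy.
Qed.

Lemma harmonic_cst (a : R) : Defs.harmonic adj (fun=> a : R).
Proof. by apply/harmonicP => x; rewrite child_sum_const subrr addr0. Qed.

Lemma harmonicD f g : Defs.harmonic adj f -> Defs.harmonic adj g ->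
  Defs.harmonic adj (fun y => f y + g y).
Proof.
move=> /harmonicP hf /harmonicP hg; apply/harmonicP => x.
by rewrite child_sumD hf hg; ring.
Qed.

Lemma harmonic_sum (r : seq nat) (F : nat -> V -> R) :
  (forall i, i \in r -> Defs.harmonic adj (F i)) ->
  Defs.harmonic adj (fun y => \sum_(i <- r) F i y).
Proof.
elim: r => [|i r IH] H.
  have -> : (fun y => \sum_(i <- [::]) F i y) = fun=> 0.
    by apply/funext => y; rewrite big_nil.
  exact: harmonic_cst.
have -> : (fun y => \sum_(i <- i :: r) F i y) = fun y => F i y + \sum_(i <- r) F i y.
  by apply/funext => y; rewrite big_cons.
apply: harmonicD; first by apply: H; rewrite mem_head.
by apply: IH => j jr; apply: H; rewrite inE jr orbT.
Qed.

(** Above height [k] the term is [phi k] times a function constant on branches,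
    below height [k] it vanishes, and at height [k] its values at the children of
    [ancestor x k] add up to zero: 1 - q * (1 / q). *)
Lemma harmonic_kernel_term x k : (k < height x)%N ->
  Defs.harmonic adj (kernel_term x k).
Proof.
move=> kx; apply/harmonicP => y.
set u := ancestor x k.+1; set z := ancestor x k.
have hu : height u = k.+1 by rewrite height_ancestor.
have hz : height z = k by rewrite height_ancestor// ltnW.
pose a v : R := \1_(sector u) v - (q k)%:R^-1 * \1_(sector z) v.
pose C := (phi_moment 2 k)^-1 * phi k (height x).
have E v : kernel_term x k v = C * phi k (height v) * a v by [].
have -> : child_sum (kernel_term x k) y =
    child_sum (fun v => C * phi k (height y).+1 * a v) y.
  by apply: eq_child_sum => v yv; rewrite E (height_children yv).
rewrite child_sumZ !E height_parent; have [ky|yk|ky] := ltngtP k (height y).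
- have -> : child_sum a y = (q (height y))%:R * a y.
    rewrite -child_sum_const; apply: eq_child_sum => v yv.
    rewrite /a (indic_sector_child yv) ?hu// (indic_sector_child yv)//.
    by rewrite hz ltnW.
  have -> : C * phi k (height y).-1 * a (parent y) = C * phi k (height y).-1 * a y.
    have yo : y <> o by move=> e; move: ky; rewrite e height_origin.
    have yc : children (parent y) y by apply/childrenE.
    have hy := height_parent y.
    case: (ltngtP k (height y).-1) => [lt|gt|e]; last first.
    + by rewrite -e phi_small// !(mulr0,mul0r).
    + by move: gt; lia.
    congr (_ * _); rewrite /a (indic_sector_child yc) ?hu ?hy//.
    by rewrite (indic_sector_child yc) ?hz ?hy// ltnW.
  rewrite mulrCA mulrA (mulrC C) [in LHS]mulrA phi_harmonic//; ring.
- by rewrite !phi_small ?(ltnW yk)//; [ring|lia].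
rewrite -ky phi_succ !phi_small ?leq_pred// !(mulr0, mul0r) subrr addr0 mulr1.
suff -> : child_sum a y = 0 by rewrite mulr0.
have -> : child_sum a y = child_sum (fun v => \1_(sector v) u
    + - (q k)%:R^-1 * \1_(sector z) y) y.
  apply: eq_child_sum => v yv; rewrite /a mulNr (@indic_sector_child z y v) ?hz -?ky//.
  by rewrite (@indic_sector_sym u v)// hu (height_children yv) -ky.
rewrite child_sumD -indic_sector_children ?hu -?ky// child_sum_const -ky.
rewrite (@indic_sector_child y z u) ?hz -?ky//; last exact: children_ancestor.
by rewrite indic_sector_sym ?hz//; have Q0 := q_neq0 k; field.
Qed.

Lemma harmonic_kernel x : Defs.harmonic adj (kernel x).
Proof.
apply: harmonicD; first exact: harmonic_cst.
by apply: harmonic_sum => k; rewrite mem_index_iota => /andP[_]; exact: harmonic_kernel_term.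
Qed.

(** Summation by parts: the coefficient of the increment [a k.+1 - a k] is
    [phi k n - phi k.+1 n / q k.+1], which is 1 by [phi_recl].  At [k = 0] the
    predecessor convention makes the previous increment zero. *)
Lemma sum_phi_telescope (a : nat -> R) n :
  \sum_(0 <= k < n) phi k n *
    ((a k.+1 - a k) - (q k)%:R^-1 * (a k - a k.-1)) = a n - a 0%N.
Proof.
(* The tail of the sum from [m] on, by descending induction on [m]. *)
suff H d m : (m + d)%N = n -> \sum_(m <= k < n) phi k n *
    ((a k.+1 - a k) - (q k)%:R^-1 * (a k - a k.-1)) =
    a n - a m - phi m n * ((q m)%:R^-1 * (a m - a m.-1)).
  by rewrite (H n 0%N)//= subrr !mulr0 subr0.
elim: d m => [|d IH] m; first by rewrite addn0 => ->; rewrite big_geq// phi_small//; ring.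
move=> mn; have lt : (m < n)%N by rewrite -mn; lia.
by rewrite big_ltn// IH ?addSnnS//= (phi_recl lt); ring.
Qed.

(** Up to the factor 4, [kernel_term x k] is dominated by normalized indicators of
    the sector of the child towards [x] and of its siblings; the 4 is the square
    of the bound on [phi], and [phi >= 1] bounds the normalization from below. *)
Definition kernel_majorant (x : V) (k : nat) (y : V) : R :=
  (sector_mass (ancestor x k.+1))^-1 * (\1_(sector (ancestor x k.+1)) y +
    (q k)%:R^-1 * child_sum (fun v => \1_(sector v) y) (ancestor x k)).

Lemma kernel_majorant_ge0 x k y : 0 <= kernel_majorant x k y.
Proof.
apply: mulr_ge0; first by rewrite invr_ge0 ltW// sector_mass_gt0.
apply: addr_ge0; first by rewrite indicE ler0n.
apply: mulr_ge0 => //; apply: sumr_ge0 => v _; by rewrite indicE ler0n.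
Qed.

Lemma kernel_term_le x k y : (k < height x)%N ->
  `|kernel_term x k y| <= 4 * kernel_majorant x k y.
Proof.
move=> kx; have [ky|yk] := ltnP k (height y); last first.
  rewrite /kernel_term (phi_small yk) mulr0 mul0r normr0.
  by rewrite mulr_ge0// kernel_majorant_ge0.
set u := ancestor x k.+1; have hu : height u = k.+1 by rewrite height_ancestor.
rewrite /kernel_term /kernel_majorant -/u -indic_sector_children; last first.
  by rewrite height_ancestor// ltnW.
have m0 := sector_mass_gt0 u; have N0 := phi_moment_gt0 kx.
rewrite normrM (mulrA 4); apply: ler_pM => //.
  rewrite !normrM !(ger0_norm (phi_ge0 _ _)) ger0_norm ?invr_ge0 ?(ltW N0)//.
  have -> : 4 * (sector_mass u)^-1 = (sector_mass u)^-1 * 2 * 2 by ring.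
  have le1 : (phi_moment 2 k)^-1 <= (sector_mass u)^-1.
    by rewrite lef_pV2 ?posrE//; exact: le_sector_mass_phi_moment.
  apply: ler_pM; rewrite ?mulr_ge0 ?invr_ge0 ?phi_ge0 ?phi_le2 ?(ltW N0)//.
  by apply: ler_pM; rewrite ?invr_ge0 ?phi_ge0 ?phi_le2 ?(ltW N0).
apply: le_trans (ler_normB _ _) _.
by rewrite normrM !ger0_norm// ?indicE ?ler0n.
Qed.

Lemma kernel_le x y :
  `|kernel x y| <= 1 + 4 * \sum_(0 <= k < height x) kernel_majorant x k y.
Proof.
apply: le_trans (ler_normD _ _) _; rewrite normr1 lerD2l mulr_sumr.
apply: le_trans (ler_norm_sum _ _ _) _; rewrite !big_nat; apply: ler_sum => k /andP[_ kx].
exact: kernel_term_le.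
Qed.

Lemma kernel_term_bounded x k : exists B, forall y, `|kernel_term x k y| <= B.
Proof.
exists (`|(phi_moment 2 k)^-1| * 2 * 2 * (1 + (q k)%:R^-1 * 1)) => y.
rewrite /kernel_term normrM; apply: ler_pM => //.
  rewrite !normrM !(ger0_norm (phi_ge0 _ _)).
  by do ?[apply: ler_pM]; rewrite ?mulr_ge0 ?phi_ge0 ?phi_le2.
apply: le_trans (ler_normB _ _) _; apply: lerD; first exact: indic_bound.
by rewrite normrM ger0_norm//; apply: ler_pM => //; exact: indic_bound.
Qed.

Lemma kernel_bounded x : exists B, forall y, `|kernel x y| <= B.
Proof.
exists (1 + \sum_(0 <= k < height x) xget 0 [set B | forall y, `|kernel_term x k y| <= B]).
move=> y; apply: le_trans (ler_normD _ _) _; rewrite normr1 lerD2l.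
apply: le_trans (ler_norm_sum _ _ _) _; apply: ler_sum => k _.
exact: (xgetPex 0 (kernel_term_bounded x k)).
Qed.

Lemma bergman_abs_summable f : inL2 w f -> abs_summable [set: V] (fun y => f y * w y).
Proof.
move=> f2; have S : abs_summable [set: V] (fun y => w y + f y ^+ 2 * w y).
  apply: abs_summableD; first exact: abs_summable_weight.
  rewrite abs_summable_ge0E; first exact: f2.
  by move=> y _; rewrite mulr_ge0 ?weight_ge0 ?sqr_ge0.
apply: abs_summable_le S => y _; rewrite normrM (ger0_norm (weight_ge0 y)).
rewrite -[X in X + _]mul1r -mulrDl ler_wpM2r ?weight_ge0//.
have := sqr_ge0 (`|f y| - 1); rewrite sqrrB real_normK ?num_real// => H.
have := normr_ge0 (f y); lra.
Qed.

Lemma bergman_kernel_mem x : bergman adj w (kernel x).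
Proof.
split; last exact: harmonic_kernel.
have [B hB] := kernel_bounded x.
have S : abs_summable [set: V] (fun y => kernel x y ^+ 2 * w y).
  apply: (@abs_summable_bounded _ _ _ _ (B ^+ 2)); last exact: abs_summable_weight.
  by move=> y _; rewrite normrX lerXn2r ?nnegrE// (le_trans _ (hB y)).
rewrite abs_summable_ge0E in S; first exact: S.
by move=> y _; rewrite mulr_ge0 ?weight_ge0 ?sqr_ge0.
Qed.

Lemma rsum_kernel_term f x k : Defs.harmonic adj f ->
  abs_summable [set: V] (fun y => f y * w y) -> (k < height x)%N ->
  rsum [set: V] (fun y => kernel_term x k y * (f y * w y)) =
  phi k (height x) * ((f (ancestor x k.+1) - f (ancestor x k))
    - (q k)%:R^-1 * (f (ancestor x k) - f (ancestor x k.-1))).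
Proof.
move=> harm fw kx.
set u := ancestor x k.+1; set z := ancestor x k.
have hu : height u = k.+1 by rewrite height_ancestor.
have hz : height z = k by rewrite height_ancestor// ltnW.
have pu : parent u = z by exact: parent_ancestor.
pose h y := phi k (height y) * f y * w y.
have hs : abs_summable [set: V] h.
  have : abs_summable [set: V] (fun y => phi k (height y) ^+ 1 * (f y * w y)).
    by apply: abs_summable_bounded fw => y _; exact: phi_pow_bound.
  by apply: abs_summable_eq => y _; rewrite /h mulrA.
have Sz : rsum (sector z) h = child_sum (fun v => rsum (sector v) h) z.
  rewrite -rsum_indic.
  have -> : rsum [set: V] (fun y => \1_(sector z) y * h y) =
      rsum [set: V] (fun y => child_sum (fun v => \1_(sector v) y * h y) z).
    apply: eq_rsum => y _; have [ky|yk] := ltnP k (height y).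
      by rewrite indic_sector_children ?hz// /child_sum mulr_suml.
    rewrite /h (phi_small yk) !(mul0r, mulr0).
    by rewrite /child_sum big1// => v _; rewrite mulr0.
  rewrite /child_sum rsum_sum; last by move=> v _; exact: abs_summable_indic.
  by apply: eq_bigr => v _; rewrite rsum_indic.
have Nn0 : phi_moment 2 k != 0 by rewrite gt_eqF// (phi_moment_gt0 kx).
transitivity ((phi_moment 2 k)^-1 * phi k (height x) *
    (rsum (sector u) h - (q k)%:R^-1 * rsum (sector z) h)).
  rewrite -!(rsum_indic _ h) -rsumZ; last exact: abs_summable_indic.
  rewrite -rsumB; [|exact: abs_summable_indic|exact/abs_summableZ/abs_summable_indic].
  rewrite -rsumZ; last first.
    apply: abs_summable_eq (abs_summableD (abs_summable_indic (sector u) hs)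
      (abs_summableZ (- (q k)%:R^-1) (abs_summable_indic (sector z) hs))) => y _.
    by rewrite mulNr.
  by apply: eq_rsum => y _; rewrite /kernel_term /h -/u -/z; ring.
have -> : rsum (sector z) h = child_sum (fun v =>
    f z * (phi_moment 1 k - phi_moment 2 k) + phi_moment 2 k * f v) z.
  rewrite Sz; apply: eq_child_sum => v zv.
  by rewrite rsum_sector_harmonic ?(height_children zv) ?hz// (parent_children zv); ring.
rewrite child_sumD child_sum_const child_sumZ (harmonicP f).1// hz.
rewrite rsum_sector_harmonic// pu.
have -> : parent z = ancestor x k.-1.
  case: k kx @z {hs Sz u hu pu h hz Nn0} => [|k] kx z.
    by rewrite /z ancestor0 parent_origin.
  by apply: parent_ancestor; exact: ltnW.
have Q0 := q_neq0 k; by field; rewrite Q0.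
Qed.

Lemma kernel_reproducing f x : bergman adj w f -> f x = inner w f (kernel x).
Proof.
case=> /bergman_abs_summable fw harm.
have Kt k : abs_summable [set: V] (fun y => kernel_term x k y * (f y * w y)).
  by have [B hB] := kernel_term_bounded x k; apply: (@abs_summable_bounded _ _ _ _ B).
rewrite /inner (_ : rsum _ _ = rsum [set: V] (fun y => f y * w y +
    \sum_(0 <= k < height x) kernel_term x k y * (f y * w y))); last first.
  by apply: eq_rsum => y _; rewrite /kernel -mulr_suml; ring.
rewrite rsumD//; last exact: abs_summable_sum.
rewrite rsum_harmonic// rsum_sum//.
have -> : \sum_(0 <= k < height x) rsum [set: V] (fun y => kernel_term x k y * (f y * w y))
  = f x - f o.
  have := sum_phi_telescope (fun k => f (ancestor x k)) (height x).
  rewrite /= ancestor_height ancestor0 => <-.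
  by rewrite !big_nat; apply: eq_bigr => k /andP[_ kx]; exact: rsum_kernel_term.
by rewrite addrC subrK.
Qed.

(** Two reproducing kernels coincide: evaluate the section at [x] of one at [z]
    with the other and use the symmetry of [kernel]. *)
Lemma bergman_kernelE x y : bergman_kernel adj w x y = kernel x y.
Proof.
congr (_ y); apply: xget_unique.
  by split; [exact: bergman_kernel_mem|move=> f; exact: kernel_reproducing].
move=> k [kB kR]; apply/funext => z; rewrite (kernel_reproducing z kB) kernelC.
rewrite (kR _ (bergman_kernel_mem z)) /inner; apply: eq_rsum => t _; ring.
Qed.

(** * Sparse families of sectors *)

(** A level has q times as many vertices as the previous one, each lighter by the
    factor q^-alpha, and q^(1 - alpha) is largest for q = 2. *)
Lemma level_mass_decay k n m :
  level_count k (n + m) * level_weight (k + (n + m)) <=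
  (2 `^ (1 - alpha)) ^+ m * (level_count k n * level_weight (k + n)).
Proof.
elim: m => [|m IH]; first by rewrite addn0 expr0 mul1r.
rewrite addnS exprS -mulrA.
have r0 : 0 <= 2 `^ (1 - alpha) :> R by exact: powR_ge0.
apply: le_trans (ler_wpM2l r0 IH); rewrite addnS.
have -> : level_count k (n + m).+1 * level_weight (k + (n + m)).+1 =
    (q (k + (n + m)))%:R `^ (1 - alpha) *
    (level_count k (n + m) * level_weight (k + (n + m))).
  rewrite /level_count /level_weight !big_ord_recr /=.
  rewrite powRD ?q_neq0 ?implybT// powRr1 ?ler0n//; ring.
apply: ler_wpM2r.
  by rewrite mulr_ge0 ?level_count_ge0// ltW// level_weight_gt0.
rewrite -opprB !powRN lef_pV2 ?posrE ?powR_gt0//.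
by apply: ge0_ler_powR; rewrite ?nnegrE ?subr_ge0 ?(ltW alpha_gt1) ?ler0n ?ler_nat.
Qed.

Lemma level_gap : exists2 m, (0 < m)%N & (2 `^ (1 - alpha)) ^+ m <= 2^-1.
Proof.
have a0 : 0 < alpha - 1 by rewrite subr_gt0.
exists (Num.bound (alpha - 1)^-1).
  by rewrite -(ltr_nat R); apply: le_lt_trans (archi_boundP _); rewrite invr_ge0 ltW.
set m := Num.bound _; have am : (alpha - 1)^-1 < m%:R.
  by apply: archi_boundP; rewrite invr_ge0 ltW.
rewrite -powR_mulrn ?powR_ge0// -powRrM -opprB mulNr powRN.
rewrite lef_pV2 ?posrE ?powR_gt0//.
rewrite -[X in X <= _]powRr1//; apply: ler_powR; first by rewrite ler1n.
by rewrite -ler_pdivrMl// mulr1 ltW.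
Qed.

Definition level_class (m i : nat) : set V := [set u | height u %% m = i]%N.

Definition level_sectors (m i : nat) : set (set V) := sector @` level_class m i.

Definition sector_top (m : nat) (Q : set V) : set V :=
  Q `&` [set y | height y < height (sector_vertex adj o Q) + m]%N.

Lemma sector_top_mass m u : (2 `^ (1 - alpha)) ^+ m <= 2^-1 ->
  ((2^-1)%:E * mass w (sector u) <= mass w (sector_top m (sector u)))%E.
Proof.
move=> rm; rewrite /sector_top sector_vertexE.
have w0 y : (0 <= (w y)%:E)%E by rewrite lee_fin weight_ge0.
set B := [set y | _]; pose rest := sector u `&` ~` B.
have restE : rest = \bigcup_n descendants (n + m) u.
  apply/seteqP; split=> y.
    move=> [su /negP]; rewrite -leqNgt => hy; have /sectorE[_ ay] := su.
    exists (height y - height u - m)%N => //; rewrite /descendants /=.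
    by rewrite subnK ?leq_subRL//; [split=> //; lia|lia].
  move=> [n _ [yu hy]]; split; first by exists (n + m)%N.
  by apply/negP; rewrite /B /= hy -leqNgt leq_add2l leq_addl.
have rest_mass : mass w rest = (rsum rest w)%:E.
  rewrite EFin_rsum//; last exact: abs_summable_weight.
  by move=> y _; exact: weight_ge0.
have rest_le : rsum rest w <= 2^-1 * sector_mass u.
  have triv : trivIset [set: nat] (fun n => descendants (n + m) u).
    by move=> n n' _ _ [z [[_ hz] [_]]]; rewrite hz => /addnI/addIn.
  have sw := abs_summable_weight rest; rewrite restE in sw *.
  rewrite rsum_partition//.
  have sl := abs_summable_levels (abs_summable_weight (sector u)).
  rewrite /sector_mass rsum_sector; last exact: abs_summable_weight.
  rewrite -rsumZ//; apply: le_rsum.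
  - exact: (abs_summable_partition triv sw).
  - exact: abs_summableZ.
  move=> n _; rewrite rsum_descendants !iter_child_sum_weight; apply: le_trans (level_mass_decay _ _ _) _.
  apply: ler_wpM2r => //; rewrite -iter_child_sum_weight -rsum_descendants.
  apply: rsum_ge0; last exact: abs_summable_weight.
  by move=> y _; exact: weight_ge0.
have topE : mass w (sector u `&` B) = (rsum (sector u `&` B) w)%:E.
  rewrite EFin_rsum//; last exact: abs_summable_weight.
  by move=> y _; exact: weight_ge0.
have : mass w (sector u) = (mass w (sector u `&` B) + mass w rest)%E.
  by apply: esumID => y _; exact: w0.
rewrite rest_mass topE sector_massE -EFinD -EFinM lee_fin => -[E].
by move: rest_le; rewrite E; lra.
Qed.

(** If two sectors of the family meet, one vertex is an ancestor of the other, and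
    their heights are equal or differ by at least [m]; in the second case the first
    [m] levels of the larger sector end before the smaller one begins. *)
Lemma sparse_level_sectors m i : (0 < m)%N -> (2 `^ (1 - alpha)) ^+ m <= 2^-1 ->
  sparse adj o w (level_sectors m i).
Proof.
move=> m0 rm; split; first by move=> Q [u _ <-]; left; exists u.
exists (sector_top m).
  by move=> Q [u _ <-]; split; [move=> y []|exact: sector_top_mass].
move=> Q Q' [u hu <-] [v hv <-]; rewrite /sector_top !sector_vertexE.
move=> [y [[yu yum] [yv yvm]]]; congr sector.
have [/sectorE[uy au] /sectorE[vy av]] := (yu, yv).
suff e : height u = height v by rewrite -au -av e.
wlog lt : u v hu hv yu yv yum yvm uy vy au av / (height u < height v)%N.
  move=> H; case: (ltngtP (height u) (height v)) => // lt; first exact: (H u v).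
  by apply/esym/(H v u).
have : (height v = height u %[mod m])%N by rewrite hu hv.
move=> /eqP; rewrite eqn_mod_dvd 1?ltnW// => /dvdn_leq.
rewrite subn_gt0 => /(_ lt) mle; move: yum; rewrite /= => yum; lia.
Qed.

(** * Domination of the projector *)

Definition average_on g u : R := average w g (sector u).

(** The normalization is the number of siblings of [u], itself included.  The origin
    has no siblings, while [parent o = o], hence the case distinction. *)
Definition sibling_average g u : R :=
  if u == o then 0 else
  (q (height u).-1)%:R^-1 * child_sum (average_on g) (parent u).

Lemma average_onE g u :
  average_on g u = (sector_mass u)^-1 * rsum (sector u) (fun y => g y * w y).
Proof. by rewrite /average_on /average sector_massE. Qed.

Lemma sector_mass_origin : sector_mass o = 1.
Proof. by apply: EFin_inj; rewrite -sector_massE sector_origin. Qed.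

Lemma average_on_rsum g u :
  average_on g u * sector_mass u = rsum (sector u) (fun y => g y * w y).
Proof. by rewrite average_onE mulrC mulVKf// gt_eqF// sector_mass_gt0. Qed.

Section NonnegativeDensity.
Variable g : V -> R.
Hypotheses (g_ge0 : forall x, 0 <= g x)
  (g_sum : abs_summable [set: V] (fun y => g y * w y)).

Lemma abs_summable_sector u : abs_summable (sector u) (fun y => g y * w y).
Proof. exact: abs_summable_sub g_sum. Qed.

Lemma average_on_ge0 u : 0 <= average_on g u.
Proof.
rewrite average_onE mulr_ge0 ?invr_ge0 ?(ltW (sector_mass_gt0 u))//.
apply: rsum_ge0; last exact: abs_summable_sector.
by move=> y _; rewrite mulr_ge0 ?weight_ge0.
Qed.

Lemma sibling_average_ge0 u : 0 <= sibling_average g u.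
Proof.
rewrite /sibling_average; case: ifP => // _; apply: mulr_ge0 => //.
by apply: sumr_ge0 => v _; exact: average_on_ge0.
Qed.

Lemma rsum_kernel_majorant x k : (k < height x)%N ->
  abs_summable [set: V] (fun y => kernel_majorant x k y * (g y * w y)) /\
  rsum [set: V] (fun y => kernel_majorant x k y * (g y * w y)) =
  average_on g (ancestor x k.+1) + sibling_average g (ancestor x k.+1).
Proof.
move=> kx; set u := ancestor x k.+1; set z := ancestor x k.
have hu : height u = k.+1 by rewrite height_ancestor.
have zu : children z u by exact: children_ancestor.
have uo : u <> o by case/childrenE: zu.
pose h y := g y * w y.
have I v : abs_summable [set: V] (fun y => \1_(sector v) y * h y).
  exact: abs_summable_indic.
have Ic : abs_summable [set: V] (fun y => child_sum (fun v => \1_(sector v) y * h y) z).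
  exact: abs_summable_sum.
have E y : kernel_majorant x k y * h y = (sector_mass u)^-1 *
    (\1_(sector u) y * h y + (q k)%:R^-1 * child_sum (fun v => \1_(sector v) y * h y) z).
  by rewrite /kernel_majorant -/u -/z /child_sum -mulr_suml; ring.
have S : abs_summable [set: V] (fun y => \1_(sector u) y * h y +
    (q k)%:R^-1 * child_sum (fun v => \1_(sector v) y * h y) z).
  by apply: abs_summableD => //; exact: abs_summableZ.
split.
  by apply: abs_summable_eq (abs_summableZ _ S) => y _; exact: E.
rewrite (eq_rsum (fun y _ => E y)) rsumZ// rsumD//; last exact: abs_summableZ.
rewrite rsumZ// rsum_indic /child_sum rsum_sum// average_onE mulrDr; congr (_ + _).
rewrite /sibling_average; have /eqP/negPf -> := uo.
rewrite hu /= mulrCA; congr (_ * _).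
rewrite (parent_children zu) -/(child_sum _ z) -/(child_sum _ z) -child_sumZ.
apply: eq_child_sum => v zv; rewrite rsum_indic average_onE.
by congr (_^-1 * _); apply: eq_sector_mass; rewrite (height_children zv) (height_children zu).
Qed.

End NonnegativeDensity.

(** The constant term of the kernel contributes the average over the whole tree,
    that is over the sector of the origin. *)
Lemma projector_le f x : abs_summable [set: V] (fun y => `|f y| * w y) ->
  `|bergman_projector adj w f x| <= 4 * \sum_(0 <= j < (height x).+1)
    (average_on (fun y => `|f y|) (ancestor x j) +
     sibling_average (fun y => `|f y|) (ancestor x j)).
Proof.
move=> fs; set g : V -> R := fun y => `|f y|.
have g0 y : 0 <= g y by exact: normr_ge0.
have M k (kx : (k < height x)%N) := @rsum_kernel_majorant g fs x k kx.
have [B hB] := kernel_bounded x.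
have S : abs_summable [set: V] (fun y => kernel x y * (f y * w y)).
  apply: (abs_summable_bounded (B := B)) => //.
  by apply: abs_summable_le fs => y _; rewrite normrM (ger0_norm (weight_ge0 y)).
rewrite /bergman_projector (eq_rsum (g := fun y => kernel x y * (f y * w y))); last first.
  by move=> y _; rewrite bergman_kernelE mulrA.
apply: le_trans (le_normr_rsum S) _.
pose T y := g y * w y + 4 * \sum_(0 <= k < height x) kernel_majorant x k y * (g y * w y).
have Ss : abs_summable [set: V]
    (fun y => \sum_(0 <= k < height x) kernel_majorant x k y * (g y * w y)).
  apply: abs_summable_eq (_ : abs_summable [set: V] (fun y =>
    \sum_(k < height x) kernel_majorant x k y * (g y * w y))).
    by move=> y _; rewrite big_mkord.
  by apply: abs_summable_sum => k _; case: (M k (ltn_ord k)).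
apply: (@le_trans _ _ (rsum [set: V] T)).
  apply: le_rsum; first exact: abs_summable_abs.
    by apply: abs_summableD => //; exact: abs_summableZ.
  move=> y _ /=.
  have -> : T y = (1 + 4 * \sum_(0 <= k < height x) kernel_majorant x k y) * (g y * w y).
    by rewrite /T -mulr_suml; ring.
  rewrite (normrM (kernel x y)) (normrM (f y)) (ger0_norm (weight_ge0 y)) -/(g y).
  by rewrite ler_wpM2r ?kernel_le// mulr_ge0// weight_ge0.
rewrite rsumD//; last exact: abs_summableZ.
rewrite rsumZ//.
have -> : rsum [set: V] (fun y => g y * w y) = average_on g o.
  by rewrite -sector_origin -average_on_rsum sector_mass_origin mulr1.
have -> : rsum [set: V] (fun y => \sum_(0 <= k < height x)
    kernel_majorant x k y * (g y * w y)) =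
   \sum_(0 <= k < height x) (average_on g (ancestor x k.+1) +
     sibling_average g (ancestor x k.+1)).
  rewrite [RHS]big_mkord -(eq_bigr _ (fun k _ => (M _ (ltn_ord k)).2)).
  rewrite -rsum_sum; last by move=> k _; case: (M k (ltn_ord k)).
  by apply: eq_rsum => y _; rewrite big_mkord.
have sib0 : sibling_average g o = 0 by rewrite /sibling_average eqxx.
rewrite big_nat_recl//= ancestor0 sib0 addr0 mulrDr lerD2r.
by rewrite ler_peMl ?average_on_ge0// ler1n.
Qed.

(** * The sparse and sibling forms of a family of sectors *)

Lemma esum_exchange (A B : choiceType) (I : set A) (J : set B) (a : A -> B -> \bar R) :
  (forall i j, 0 <= a i j)%E ->
  (\esum_(i in I) \esum_(j in J) a i j = \esum_(j in J) \esum_(i in I) a i j)%E.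
Proof.
move=> a0; rewrite !esum_esum//.
rewrite (reindex_esum (J `*`` (fun=> I)) _ (fun p => (p.2, p.1)))//; split=> /=.
- by move=> [j i] [].
- by move=> [j i] [j' i'] _ _ [-> ->].
- by move=> [i j] [/= Ii Jj]; exists (j, i).
Qed.

Lemma set_inj_ancestor x (A : set nat) :
  (forall j, A j -> (j <= height x)%N) -> set_inj A (ancestor x).
Proof.
move=> Ax j j' /set_mem Aj /set_mem Aj' e.
by rewrite -(height_ancestor (Ax _ Aj)) e height_ancestor// Ax.
Qed.

Definition class_levels (m i x : nat) : seq nat :=
  [seq j <- index_iota 0 x.+1 | j %% m == i]%N.

Lemma level_class_ancestors m i x :
  level_class m i `&` [set u | sector u x] =
  ancestor x @` [set` class_levels m i (height x)].
Proof.
apply/seteqP; split=> u.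
  move=> [hu /= su]; have /sectorE[ux au] := su.
  exists (height u) => //=; rewrite mem_filter mem_index_iota ltnS ux andbT.
  by rewrite leq0n andbT; apply/eqP.
move=> [j /=]; rewrite mem_filter mem_index_iota ltnS /= => /andP[/eqP ji jx] <-.
by split; [rewrite /level_class /= height_ancestor|exact: sector_ancestor].
Qed.

Lemma class_levels_le m i x j : [set` class_levels m i (height x)] j -> (j <= height x)%N.
Proof. by rewrite /= mem_filter mem_index_iota ltnS => /and3P[]. Qed.

Lemma esum_level_class m i x (F : V -> R) : (forall u, 0 <= F u) ->
  (\esum_(u in level_class m i) (\1_(sector u) x * F u)%:E =
   (\sum_(0 <= j < (height x).+1 | (j %% m == i)%N) F (ancestor x j))%:E)%E.
Proof.
move=> F0.
transitivity (\esum_(u in level_class m i `&` [set u | sector u x]) (F u)%:E).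
  rewrite esum_mkcondr; apply: eq_esum => u _; rewrite indicE.
  have -> : (x \in sector u) = (u \in [set u | sector u x]).
    by apply/idP/idP; rewrite !inE.
  by case: ifP; rewrite ?mul1r ?mul0r.
rewrite level_class_ancestors esum_image; last first.
  by apply: set_inj_ancestor; exact: class_levels_le.
rewrite esum_fset; [|exact: finite_seq|by move=> j _; rewrite lee_fin].
by rewrite -fsbig_seq ?filter_uniq ?iota_uniq// big_filter sumEFin.
Qed.

Lemma sparse_operator_level_sectors m i g x :
  sparse_operator w (level_sectors m i) g x =
  \sum_(0 <= j < (height x).+1 | (j %% m == i)%N) average_on g (ancestor x j).
Proof.
have sub : sector @` (ancestor x @` [set` class_levels m i (height x)])
    `<=` level_sectors m i.
  by rewrite -level_class_ancestors => Q [u [hu _] <-]; exists u.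
rewrite /sparse_operator -(@fsbig_widen _ _ _ _ _ _ _ sub); last first.
  move=> _ [[u hu <-]]; rewrite -level_class_ancestors => ns.
  rewrite /= indicE memNset ?mulr0// => su; apply: ns.
  by exists u.
rewrite fsbig_image; last by move=> u v _ _; exact: sector_inj.
rewrite fsbig_image; last by apply: set_inj_ancestor; exact: class_levels_le.
rewrite -fsbig_seq ?filter_uniq ?iota_uniq// big_filter; apply: eq_bigr => j _.
by rewrite indicE mem_set ?mulr1//; exact: sector_ancestor.
Qed.

Definition proper_class (m i : nat) : set V := level_class m i `\ o.

Lemma proper_level_sectors m i :
  proper_sectors adj o (level_sectors m i) = sector @` proper_class m i.
Proof.
apply/seteqP; split=> Q.
  move=> [[u hu <-] _ uT]; exists u => //; split=> //= uo.
  by apply: uT; rewrite uo sector_origin.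
move=> [u [hu uo] <-]; split; [by exists u|by exists u|].
by rewrite -sector_origin => /sector_inj.
Qed.

Lemma siblings_level_sectors m i u : proper_class m i u ->
  siblings adj o (level_sectors m i) (sector u) = sector @` children (parent u).
Proof.
move=> [hu uo]; have hp := height_gt0 uo.
rewrite /siblings proper_level_sectors; apply/seteqP; split=> Q.
  move=> [[v [hv vo] <-]]; rewrite /sector_parent !sector_vertexE.
  by move=> /sector_inj vu; exists v => //; apply/childrenE.
move=> [v pv <-]; have /childrenE[vo vp] := pv; split.
  exists v => //; split=> //; move: hu; rewrite /level_class /=.
  by rewrite (height_children pv) height_parent prednK.
by rewrite /sector_parent !sector_vertexE vp.
Qed.

Lemma sibling_form_level_sectors m i g1 g2 :
  sibling_form adj o w (level_sectors m i) g1 g2 =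
  (\esum_(u in proper_class m i)
    (average_on g1 u * sibling_average g2 u * sector_mass u)%:E)%E.
Proof.
rewrite /sibling_form proper_level_sectors esum_image; last first.
  by move=> u v _ _; exact: sector_inj.
apply: eq_esum => u Uu; rewrite siblings_level_sectors//.
rewrite fsbig_image; last by move=> v v' _ _; exact: sector_inj.
rewrite fsbig_finite// sector_massE sector_vertexE /sibling_average.
have [_ /eqP/negPf ->] := Uu.
by have [_ ->] := radV (parent u); rewrite height_parent.
Qed.

Lemma proper_class_children m i : proper_class m i =
  \bigcup_(z in [set z | (height z).+1 %% m = i]%N) children z.
Proof.
apply/seteqP; split=> u.
  move=> [hu uo]; exists (parent u); last exact/childrenE.
  by rewrite /= height_parent prednK// height_gt0.
move=> [z hz zu]; have /childrenE[uo _] := zu; split=> //.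
by rewrite /level_class /= (height_children zu).
Qed.

(** On the children of a given vertex both sides are the product of the sums of
    the averages of [g1] and [g2], because siblings have the same mass. *)
Lemma sibling_form_swap m i g1 g2 :
  (forall x, 0 <= g1 x) -> abs_summable [set: V] (fun y => g1 y * w y) ->
  (forall x, 0 <= g2 x) -> abs_summable [set: V] (fun y => g2 y * w y) ->
  (\esum_(u in proper_class m i)
    (average_on g1 u * sibling_average g2 u * sector_mass u)%:E =
  \esum_(u in proper_class m i)
    (sibling_average g1 u * average_on g2 u * sector_mass u)%:E)%E.
Proof.
move=> g10 s1 g20 s2.
have nonneg h h' u : (forall x, 0 <= h x) -> abs_summable [set: V] (fun y => h y * w y) ->
    (forall x, 0 <= h' x) -> abs_summable [set: V] (fun y => h' y * w y) ->
    0 <= average_on h u * sibling_average h' u * sector_mass u.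
  move=> h0 hs h'0 h's; apply: mulr_ge0; last exact/ltW/sector_mass_gt0.
  by apply: mulr_ge0; [exact: average_on_ge0|exact: sibling_average_ge0].
have nonneg' u : 0 <= sibling_average g1 u * average_on g2 u * sector_mass u.
  by rewrite (mulrC (sibling_average g1 u)); exact: nonneg.
rewrite proper_class_children.
have triv A : trivIset A children.
  by move=> z z' _ _ [u [/parent_children <- /parent_children]].
rewrite !esum_partition//; do ?by move=> u; rewrite lee_fin ?nonneg ?nonneg'.
apply: eq_esum => z _; rewrite !esum_fsetE//; last by move=> u _; exact: nonneg.
congr (_%:E); rewrite -!/(child_sum _ z).
pose L := rsum [set: nat] (fun n =>
  level_count (height z).+1 n * level_weight ((height z).+1 + n)).
have sE g u : children z u ->
    sibling_average g u = (q (height z))%:R^-1 * child_sum (average_on g) z.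
  move=> zu; have /childrenE[/eqP/negPf uo pu] := zu.
  by rewrite /sibling_average uo pu (height_children zu).
have mE u : children z u -> sector_mass u = L.
  by move=> zu; rewrite sector_mass_levels (height_children zu).
transitivity (child_sum (fun u => (q (height z))%:R^-1 * child_sum (average_on g2) z * L *
    average_on g1 u) z).
  by apply: eq_child_sum => u zu; rewrite sE// mE//; ring.
rewrite child_sumZ.
transitivity (child_sum (fun u => (q (height z))%:R^-1 * child_sum (average_on g1) z * L *
    average_on g2 u) z); last by apply: eq_child_sum => u zu; rewrite sE// mE//; ring.
by rewrite child_sumZ; ring.
Qed.

Definition class_sum (m i : nat) (F : V -> R) (x : V) : R :=
  \sum_(0 <= j < (height x).+1 | (j %% m == i)%N) F (ancestor x j).

(** Tonelli: the vertices summed over at [x] are those whose sector contains [x]. *)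
Lemma esum_class_sum m i (F g : V -> R) :
  (forall u, 0 <= F u) -> (forall x, 0 <= g x) ->
  abs_summable [set: V] (fun y => g y * w y) ->
  (\esum_(x in [set: V]) (class_sum m i F x * g x * w x)%:E =
  \esum_(u in level_class m i) (F u * average_on g u * sector_mass u)%:E)%E.
Proof.
move=> F0 g0 gs.
have gw0 x : 0 <= g x * w x by rewrite mulr_ge0// weight_ge0.
transitivity (\esum_(x in [set: V]) \esum_(u in level_class m i)
    ((F u)%:E * (\1_(sector u) x * (g x * w x))%:E))%E.
  apply: eq_esum => x _.
  have -> : (class_sum m i F x * g x * w x)%:E =
      ((g x * w x)%:E * (class_sum m i F x)%:E)%E by rewrite -EFinM; congr _%:E; ring.
  rewrite -esum_level_class// -esumZl//; last first.
    by move=> u _; rewrite lee_fin mulr_ge0// indicE ler0n.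
  by apply: eq_esum => u _; rewrite -!EFinM; congr _%:E; ring.
rewrite esum_exchange; last first.
  by move=> x u; rewrite mule_ge0 ?lee_fin// mulr_ge0// indicE ler0n.
apply: eq_esum => u _; rewrite esumZl//; last first.
  by move=> x _; rewrite lee_fin mulr_ge0// indicE ler0n.
rewrite -mulrA average_on_rsum EFinM; congr (_ * _)%E.
rewrite -[in RHS]rsum_indic EFin_rsum//; last exact: abs_summable_indic.
by move=> x _; rewrite mulr_ge0// indicE ler0n.
Qed.

Lemma class_sum_sibling_form m i g1 g2 :
  (forall x, 0 <= g1 x) -> abs_summable [set: V] (fun y => g1 y * w y) ->
  (forall x, 0 <= g2 x) -> abs_summable [set: V] (fun y => g2 y * w y) ->
  (\esum_(x in [set: V]) (class_sum m i (sibling_average g1) x * g2 x * w x)%:E =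
  sibling_form adj o w (level_sectors m i) g1 g2)%E.
Proof.
move=> g10 s1 g20 s2; have sa0 u := sibling_average_ge0 g10 s1 u.
rewrite esum_class_sum// sibling_form_level_sectors sibling_form_swap//.
rewrite /proper_class setDE esum_mkcondr; apply: eq_esum => u _.
case: ifPn => // ; rewrite notin_setE => /contrapT ->.
by rewrite /sibling_average eqxx !mul0r.
Qed.

Lemma sum_level_classes m n (a : nat -> R) : (0 < m)%N ->
  \sum_(i < m) \sum_(0 <= j < n | (j %% m == i)%N) a j = \sum_(0 <= j < n) a j.
Proof.
move=> m0; rewrite (exchange_big_dep xpredT)//=; apply: eq_bigr => j _.
by rewrite (big_pred1 (Ordinal (ltn_pmod j m0)))// => i; rewrite eq_sym.
Qed.

Lemma projector_form_le m f1 f2 g1 g2 : (0 < m)%N ->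
  g1 = (fun x => `|f1 x|) -> g2 = (fun x => `|f2 x|) ->
  abs_summable [set: V] (fun y => g1 y * w y) ->
  abs_summable [set: V] (fun y => g2 y * w y) ->
  (\esum_(x in [set: V]) `|bergman_projector adj w f1 x * f2 x * w x|%:E <=
   4%:E * \sum_(i < m) (sparse_form w (level_sectors m i) g1 g2 +
                        sibling_form adj o w (level_sectors m i) g1 g2))%E.
Proof.
move=> m0 g1E g2E s1 s2.
have g10 x : 0 <= g1 x by rewrite g1E.
have g20 x : 0 <= g2 x by rewrite g2E.
have Ple x : `|bergman_projector adj w f1 x| <= 4 * \sum_(0 <= j < (height x).+1)
    (average_on g1 (ancestor x j) + sibling_average g1 (ancestor x j)).
  by rewrite g1E in s1 *; exact: projector_le.
have n2 x : `|f2 x| = g2 x by rewrite g2E.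
have a0 u : 0 <= average_on g1 u by exact: average_on_ge0.
have b0 u : 0 <= sibling_average g1 u by exact: sibling_average_ge0.
have cs0 i (F : V -> R) x : (forall u, 0 <= F u) ->
    (0 <= (class_sum m i F x * g2 x * w x)%:E)%E.
  move=> F0; rewrite lee_fin; apply: mulr_ge0; last exact: weight_ge0.
  by apply: mulr_ge0 => //; apply: sumr_ge0.
have E (i : 'I_m) : (sparse_form w (level_sectors m i) g1 g2 +
     sibling_form adj o w (level_sectors m i) g1 g2 =
   \esum_(x in [set: V]) ((class_sum m i (average_on g1) x * g2 x * w x)%:E +
      (class_sum m i (sibling_average g1) x * g2 x * w x)%:E))%E.
  rewrite esumD; [|by move=> x _; exact: cs0|by move=> x _; exact: cs0].
  rewrite class_sum_sibling_form//; congr (_ + _)%E; apply: eq_esum => x _.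
  by rewrite sparse_operator_level_sectors.
rewrite (eq_bigr _ (fun i _ => E i)) -esum_sum; last first.
  by move=> x i _ _; rewrite adde_ge0// cs0.
rewrite -esumZl//; last first.
  by move=> x _; apply: sume_ge0 => i _; rewrite adde_ge0// cs0.
apply: le_esum => x _.
under eq_bigr do rewrite -EFinD -!mulrDl.
rewrite sumEFin -EFinM lee_fin -mulr_suml.
rewrite (normrM (_ * _)) normrM (ger0_norm (weight_ge0 x)) n2 [leRHS]mulrA.
apply: ler_wpM2r; first exact: weight_ge0.
rewrite -mulr_suml mulrA; apply: ler_wpM2r => //.
apply: le_trans (Ple x) _; rewrite ler_wpM2l//.
by rewrite big_split /= [X in _ <= X]big_split /= !sum_level_classes.
Qed.

(** * Choice of the residue class *)

Lemma sparse_domination :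
  exists C : R, 0 < C /\
    forall f1 f2 : V -> R, inL1 w f1 -> inL1 w f2 ->
      exists S : set (set V), sparse adj o w S /\
        let P := bergman_projector adj w in
        let g1 := fun x => `|f1 x| in
        let g2 := fun x => `|f2 x| in
        let rhs := (sparse_form w S g1 g2 + sibling_form adj o w S g1 g2)%E in
        ((rhs < +oo)%E -> inner_converges w (P f1) f2) /\
        (`|inner w (P f1) f2|%:E <= C%:E * rhs)%E.
Proof.
have [m m0 rm] := level_gap.
have C0 : 0 < 4 * m%:R :> R by rewrite mulr_gt0// ltr0n.
exists (4 * m%:R); split=> // f1 f2 f1L f2L.
have sum f : inL1 w f -> abs_summable [set: V] (fun y => `|f y| * w y).
  by move=> fL; rewrite abs_summable_ge0E// => y _; rewrite mulr_ge0 ?weight_ge0.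
pose h1 x := `|f1 x|; pose h2 x := `|f2 x|.
pose F (i : 'I_m) := (sparse_form w (level_sectors m i) h1 h2 +
  sibling_form adj o w (level_sectors m i) h1 h2)%E.
have [i _ Fi] := @Order.TotalTheory.arg_maxP _ _ 'I_m (Ordinal m0) xpredT F isT.
exists (level_sectors m i); split; first exact: sparse_level_sectors.
move=> P g1 g2 rhs.
have le_rhs : (\esum_(x in [set: V]) `|P f1 x * f2 x * w x|%:E <= (4 * m%:R)%:E * rhs)%E.
  apply: le_trans (projector_form_le m0 erefl erefl (sum _ f1L) (sum _ f2L)) _.
  rewrite EFinM -muleA; apply: lee_wpmul2l; first by rewrite lee_fin.
  have -> : (m%:R%:E * rhs = \sum_(j < m) rhs)%E.
    elim: (m) => [|k IH]; first by rewrite big_ord0 mul0e.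
    by rewrite big_ord_recr /= -IH -natr1 EFinD ge0_muleDl ?lee_fin// mul1e.
  by apply: lee_sum => j _; exact: Fi.
split=> [fin_rhs|]; last exact: le_trans (le_normr_rsum_esum _ _) le_rhs.
apply: le_lt_trans le_rhs _; apply: lte_mul_pinfty => //.
Qed.

End RadialTree.

Unset Implicit Arguments.

Theorem theorem1 (R : realType) (V : choiceType) (adj : rel V) (o : V)
    (q : nat -> nat) (alpha c : R)
    (treeV : is_tree adj) (infV : infinite_set [set: V])
    (q_ge2 : forall n, (2 <= q n)%N) (radV : radial adj o q)
    (alpha_gt1 : 1 < alpha) (c_gt0 : 0 < c)
    (mass1 : mass (weight adj o q alpha c) [set: V] = 1%E) :
  let mu := weight adj o q alpha c in
  exists C : R, 0 < C /\
    forall f1 f2 : V -> R, inL1 mu f1 -> inL1 mu f2 ->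
      exists S : set (set V), sparse adj o mu S /\
        let P := bergman_projector adj mu in
        let g1 := fun x => `|f1 x| in
        let g2 := fun x => `|f2 x| in
        let rhs := (sparse_form mu S g1 g2 + sibling_form adj o mu S g1 g2)%E in
        ((rhs < +oo)%E -> inner_converges mu (P f1) f2) /\
        (`|inner mu (P f1) f2|%:E <= C%:E * rhs)%E.
Proof.
exact: (sparse_domination treeV radV q_ge2 alpha_gt1 c_gt0 mass1).
Qed.
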